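(* \textsc{Weighted Set Multicover} is fixed-parameter tractable when parameterized by the size $|U|$ of the universe.
   Context: \textsc{Weighted Set Multicover}: given a universe $U=\{x_1,\dots,x_m\}$, a family (multiset) $\mathcal{S}=\{S_1,\dots,S_n\}$ of subsets of $U$, integer weights $w_1,\dots,w_n$ for the sets, integer covering requirements $r_1,\dots,r_m$ for the elements, and an integer budget $B$, decide whether there is a subfamily $\mathcal{S}'\subseteq\mathcal{S}$ such that each $x_i$ belongs to at least $r_i$ members of $\mathcal{S}'$ (counted with repetition) and $\sum_{S_j\in\mathcal{S}'}w_j\le B$. Fixed-parameter tractable means solvable in time $f(|U|)\cdot|I|^{O(1)}$ for a computable function $f$, where $|I|$ is the input encoding length. *)

(* Defs.v *)
From HB Require Import structures.
From mathcomp Require Import all_boot all_order all_algebra.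

Set Implicit Arguments.
Unset Strict Implicit.
Unset Printing Implicit Defensive.

(** * Random access machines

    The uniform-cost RAM usual in parameterized complexity: registers hold
    natural numbers, and the arithmetic is addition, truncated subtraction and
    halving.  As there is no multiplication, values gain at most one bit per
    step, so uniform-cost time is polynomially related to Turing machine time.
    The input is a read-only bit string with random access. *)

Variant instr : Type :=
  | Const of nat & nat         (* Const d k   : r_d := k *)
  | Copy of nat & nat          (* Copy d a    : r_d := r_a *)
  | Add of nat & nat & nat     (* Add d a b   : r_d := r_a + r_b *)
  | Sub of nat & nat & nat     (* Sub d a b   : r_d := max (r_a - r_b) 0 *)
  | Half of nat & nat          (* Half d a    : r_d := floor (r_a / 2) *)
  | Fetch of nat & nat         (* Fetch d a   : r_d := r_(r_a) *)
  | Store of nat & nat         (* Store a b   : r_(r_a) := r_b *)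
  | Input of nat & nat         (* Input d a   : r_d := input bit number r_a,
                                                0 beyond the end of the input *)
  | Jzero of nat & nat.        (* Jzero a l   : if r_a = 0 then goto l *)

Definition program := seq instr.
Definition memory := nat -> nat.

Definition upd (mem : memory) (d v : nat) : memory :=
  fun i => if i == d then v else mem i.

Definition exec (x : seq bool) (ins : instr) (s : nat * memory) :
    nat * memory :=
  let: (pc, r) := s in
  match ins with
  | Const d k => (pc.+1, upd r d k)
  | Copy d a => (pc.+1, upd r d (r a))
  | Add d a b => (pc.+1, upd r d (r a + r b))
  | Sub d a b => (pc.+1, upd r d (r a - r b))
  | Half d a => (pc.+1, upd r d (r a)./2)
  | Fetch d a => (pc.+1, upd r d (r (r a)))
  | Store a b => (pc.+1, upd r (r a) (r b))
  | Input d a => (pc.+1, upd r d (nat_of_bool (nth false x (r a))))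
  | Jzero a l => (if r a == 0 then l else pc.+1, r)
  end.

(* A configuration whose program counter is outside the program is halted;
   [step] leaves it unchanged. *)
Definition step (P : program) (x : seq bool) (s : nat * memory) :
    nat * memory :=
  if s.1 < size P then exec x (nth (Const 0 0) P s.1) s else s.

(* Register 0 initially holds the length of the input. *)
Definition init (x : seq bool) : nat * memory :=
  (0, upd (fun=> 0) 0 (size x)).

(* On input [x], [P] halts after at most [t] steps with [v] in register 0. *)
Definition outputs_within (P : program) (x : seq bool) (t v : nat) : Prop :=
  let s := iter t (step P x) (init x) in
  size P <= s.1 /\ s.2 0 = v.

(* Arguments are given in unary. *)
Definition computable (f : nat -> nat) : Prop :=
  exists P : program, forall k : nat,
    exists t : nat, outputs_within P (nseq k true) t (f k).

(** * Fixed-parameter tractability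

    A parameterized problem is given by a type of instances, their encoding as
    bit strings, the set of yes-instances and the parameter.  The constant
    factor hidden in a running time f(k) * |I|^O(1) is absorbed by [f]. *)

Definition fixed_parameter_tractable (T : Type) (enc : T -> seq bool)
    (yes : T -> Prop) (param : T -> nat) : Prop :=
  exists (P : program) (f : nat -> nat) (c : nat),
    computable f /\
    forall I : T, exists b : bool,
      (b <-> yes I) /\
      outputs_within P (enc I) (f (param I) * size (enc I) ^ c) b.

(** * Weighted Set Multicover *)

Record multicover_instance : Type := MulticoverInstance {
  universe_size : nat;
  family_size : nat;
  cover_set : 'I_family_size -> {set 'I_universe_size};
  weight : 'I_family_size -> int;
  requirement : 'I_universe_size -> int;
  budget : int
}.

(* The family is a multiset, so a subfamily is a set of indices. *)
Definition weighted_set_multicover (I : multicover_instance) : Prop :=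
  exists J : {set 'I_(family_size I)},
    (forall i : 'I_(universe_size I),
       (requirement i <= Posz #|[set j in J | i \in cover_set j]|)%R) /\
    (\sum_(j in J) weight j <= budget I)%R.

(* Binary digits without leading zeros, least significant first: [up_log 2 n.+1]
   is the bit length of [n]. *)
Definition binary (n : nat) : seq bool :=
  [seq odd (n %/ 2 ^ i) | i <- iota 0 (up_log 2 n.+1)].

(* Self-delimiting: every digit is preceded by 1, and a 0 ends the number. *)
Definition encode_nat (n : nat) : seq bool :=
  flatten [seq [:: true; b] | b <- binary n] ++ [:: false].

Definition encode_int (z : int) : seq bool :=
  (z < 0)%R :: encode_nat `|z|%N.

Definition encode_set (m : nat) (A : {set 'I_m}) : seq bool :=
  [seq i \in A | i <- enum 'I_m].

Definition encode_instance (I : multicover_instance) : seq bool :=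
  encode_nat (universe_size I) ++
  encode_nat (family_size I) ++
  flatten [seq encode_set (cover_set j) ++ encode_int (weight j)
             | j <- enum 'I_(family_size I)] ++
  flatten [seq encode_int (requirement i) | i <- enum 'I_(universe_size I)] ++
  encode_int (budget I).

(* Main.v *)
Require Import Defs.
From mathcomp Require Import all_boot all_order all_algebra zify.

Set Implicit Arguments.
Unset Strict Implicit.
Unset Printing Implicit Defensive.

Import Order.TTheory GRing.Theory Num.Theory.

(** Sets that contain the same elements form a type, and there are at most 2^m
    types, m being the size of the universe.  A cover may be replaced by the one
    taking, within every type, the same number of cheapest sets, so only the
    numbers of sets per type matter.

    Cap the requirements at k and let k grow from 0 to n + 1.  An optimal cover
    for k + 1 can be found close to one for k: the difference of two covers,
    together with the changes of the slacks, is a zero-sum family of vectors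
    with entries -1, 0, 1, hence splits into zero-sum blocks whose size is
    bounded in terms of m, and by optimality all blocks but those that
    contribute to the increase of the requirements (at most m) can be undone.
    So the number of sets of each type changes by at most a number depending on
    m, and each of the n + 1 stages inspects boundedly many candidates. *)

(** * A loop language and its compilation *)

(** With one integer variable per type and a convex cost this is an integer program in boundedly
    many variables; the proximity argument replaces a general solver for such programs and needs
    nothing beyond the pigeonhole principle. A common cap is raised, rather than the requirements
    one after the other, because every coordinate then grows by at most one per stage, however large
    the encoded numbers are. The last cap is n + 1 and not n: no coverage exceeds n, so a
    requirement beyond n stays visibly unsatisfiable. Weights are only added and compared, so their
    magnitude never enters a loop bound.

    The time bound concerns a concrete machine without multiplication. The algorithm is therefore
    written with bounded loops, whose cost can be read off the syntax: if all loop bounds are at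
    most N, the time is at most N to an exponent fixed by the program text. Here N is the input
    length times a function of m. To make the candidates of a stage a single such loop, they are
    coded as the numbers below a power of two, and the bound on the block sizes is relaxed to a
    double power of two that repeated doubling can compute. *)

Inductive expr : Type :=
  | EConst of nat
  | EVar of nat
  | EAdd of expr & expr
  | ESub of expr & expr
  | EHalf of expr
  | EArr of nat & expr
  | EInp of expr.

Inductive cmd : Type :=
  | Assign of nat & expr
  | AStore of nat & expr & expr
  | Seq of cmd & cmd
  | If of expr & cmd & cmd
  | For of nat & expr & cmd.

Record state : Type := State { sv : nat -> nat; av : nat -> nat -> nat }.

Definition setv (s : state) (v k : nat) : state := State (upd (sv s) v k) (av s).

Definition seta (s : state) (a i k : nat) : state :=
  State (sv s) (fun b => if b == a then upd (av s a) i k else av s b).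

Fixpoint evale (x : seq bool) (s : state) (e : expr) : nat :=
  match e with
  | EConst k => k
  | EVar v => sv s v
  | EAdd e1 e2 => evale x s e1 + evale x s e2
  | ESub e1 e2 => evale x s e1 - evale x s e2
  | EHalf e1 => (evale x s e1)./2
  | EArr a e1 => av s a (evale x s e1)
  | EInp e1 => nth false x (evale x s e1)
  end.

(* The bound of a loop is evaluated once, before the first iteration, and the
   loop variable is reset at the start of every iteration. *)
Fixpoint eval (x : seq bool) (c : cmd) (s : state) : state :=
  match c with
  | Assign v e => setv s v (evale x s e)
  | AStore a e1 e2 => seta s a (evale x s e1) (evale x s e2)
  | Seq c1 c2 => eval x c2 (eval x c1 s)
  | If e c1 c2 => if evale x s e != 0 then eval x c1 s else eval x c2 s
  | For v e c1 =>
      iteri (evale x s e) (fun i s' => eval x c1 (setv s' v i)) s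
  end.

(* Memory is split by residues modulo 4 into scalar variables, temporaries and
   the cells of eight interleaved arrays. *)
Definition reg (v : nat) : nat := 4 * v.
Definition tmp (t : nat) : nat := (4 * t).+1.
Definition cell (a i : nat) : nat := 4 * (8 * i + a) + 2.

(** Since [cell a i] is 32 i + 4 a + 2, five doublings turn the index into the address up to a
    constant. *)
Definition addr_code (a d : nat) : program :=
  nseq 5 (Add (tmp d) (tmp d) (tmp d)) ++
  [:: Const (tmp d.+1) (4 * a + 2); Add (tmp d) (tmp d) (tmp d.+1)].

(** Temporaries serve as an evaluation stack: code at depth [d] leaves its value in [tmp d] and
    overwrites no temporary below it. *)
Fixpoint cexp (e : expr) (d : nat) : program :=
  match e with
  | EConst k => [:: Const (tmp d) k]
  | EVar v => [:: Copy (tmp d) (reg v)]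
  | EAdd e1 e2 =>
      cexp e1 d ++ cexp e2 d.+1 ++ [:: Add (tmp d) (tmp d) (tmp d.+1)]
  | ESub e1 e2 =>
      cexp e1 d ++ cexp e2 d.+1 ++ [:: Defs.Sub (tmp d) (tmp d) (tmp d.+1)]
  | EHalf e1 => cexp e1 d ++ [:: Half (tmp d) (tmp d)]
  | EArr a e1 => cexp e1 d ++ addr_code a d ++ [:: Fetch (tmp d) (tmp d)]
  | EInp e1 => cexp e1 d ++ [:: Input (tmp d) (tmp d)]
  end.

Fixpoint esize (e : expr) : nat :=
  match e with
  | EConst _ | EVar _ => 1
  | EAdd e1 e2 | ESub e1 e2 => (esize e1 + esize e2).+1
  | EHalf e1 | EInp e1 => (esize e1).+1
  | EArr _ e1 => (esize e1 + 8)
  end.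

Fixpoint csize (c : cmd) : nat :=
  match c with
  | Assign _ e => (esize e).+1
  | AStore _ e1 e2 => esize e1 + esize e2 + 8
  | Seq c1 c2 => csize c1 + csize c2
  | If e c1 c2 => esize e + csize c1 + csize c2 + 3
  | For _ e c1 => esize e + csize c1 + 8
  end.

(** Jump targets are absolute, hence the load address [l]. A loop keeps its bound in [tmp d] and its
    counter in [tmp d.+1], so the body starts at depth [d.+3]. An unconditional jump is [Jzero] on a
    temporary just set to 0. *)
Fixpoint ccmd (c : cmd) (l d : nat) : program :=
  match c with
  | Assign v e => cexp e d ++ [:: Copy (reg v) (tmp d)]
  | AStore a e1 e2 =>
      cexp e1 d ++ addr_code a d ++ cexp e2 d.+1 ++
      [:: Store (tmp d) (tmp d.+1)]
  | Seq c1 c2 => ccmd c1 l d ++ ccmd c2 (l + csize c1) d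
  | If e c1 c2 =>
      let l1 := l + esize e + 1 in
      let l2 := l1 + csize c1 + 2 in
      cexp e d ++ [:: Jzero (tmp d) l2] ++ ccmd c1 l1 d ++
      [:: Const (tmp d) 0; Jzero (tmp d) (l2 + csize c2)] ++ ccmd c2 l2 d
  | For v e c1 =>
      let top := l + esize e + 1 in
      cexp e d ++
      [:: Const (tmp d.+1) 0; Defs.Sub (tmp d.+2) (tmp d) (tmp d.+1);
          Jzero (tmp d.+2) (top + csize c1 + 7); Copy (reg v) (tmp d.+1)] ++
      ccmd c1 (top + 3) d.+3 ++
      [:: Const (tmp d.+2) 1; Add (tmp d.+1) (tmp d.+1) (tmp d.+2);
          Const (tmp d.+2) 0; Jzero (tmp d.+2) top]
  end.

(** An upper bound on the machine steps. An iteration has three instructions before its body and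
    four after it; the 3 outside the sum pays for resetting the counter and for the final test. *)
Fixpoint cost (x : seq bool) (c : cmd) (s : state) : nat :=
  match c with
  | Assign _ e => (esize e).+1
  | AStore _ e1 e2 => esize e1 + esize e2 + 8
  | Seq c1 c2 => cost x c1 s + cost x c2 (eval x c1 s)
  | If e c1 c2 =>
      esize e + 3 + (if evale x s e != 0 then cost x c1 s else cost x c2 s)
  | For v e c1 =>
      let st := fun i => iteri i (fun j s' => eval x c1 (setv s' v j)) s in
      esize e + 3 + \sum_(i < evale x s e) (cost x c1 (setv (st i) v i) + 7)
  end.

Fixpoint wfe (e : expr) : bool :=
  match e with
  | EConst _ | EVar _ => true
  | EAdd e1 e2 | ESub e1 e2 => wfe e1 && wfe e2
  | EHalf e1 | EInp e1 => wfe e1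
  | EArr a e1 => (a < 8) && wfe e1
  end.

Fixpoint wfc (c : cmd) : bool :=
  match c with
  | Assign _ e => wfe e
  | AStore a e1 e2 => [&& a < 8, wfe e1 & wfe e2]
  | Seq c1 c2 => wfc c1 && wfc c2
  | If e c1 c2 => [&& wfe e, wfc c1 & wfc c2]
  | For _ e c1 => wfe e && wfc c1
  end.

Lemma size_cexp e d : size (cexp e d) = esize e.
Proof.
by elim: e d => //= [e1 h1 e2 h2|e1 h1 e2 h2|e1 h1|a e1 h1|e1 h1] d;
  rewrite !size_cat ?h1 ?h2 /=; lia.
Qed.

Lemma size_ccmd c l d : size (ccmd c l d) = csize c.
Proof.
elim: c l d => /= [v e|a e1 e2|c1 h1 c2 h2|e c1 h1 c2 h2|v e c1 h1] l d;
  rewrite !(size_cat, size_cexp) /= ?size_cat ?size_cexp /=.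
- by lia.
- by lia.
- by rewrite h1 h2.
- by rewrite h1 h2; lia.
- by rewrite h1 /=; lia.
Qed.

Definition code_at (P : program) (l : nat) (code : program) : Prop :=
  exists pre post : program, P = pre ++ code ++ post /\ size pre = l.

Lemma code_at_catl P l c1 c2 : code_at P l (c1 ++ c2) -> code_at P l c1.
Proof. by case=> pre [post [-> h]]; exists pre, (c2 ++ post); rewrite !catA. Qed.

Lemma code_at_catr P l c1 c2 :
  code_at P l (c1 ++ c2) -> code_at P (l + size c1) c2.
Proof.
case=> pre [post [-> h]]; exists (pre ++ c1), post.
by rewrite !catA size_cat h.
Qed.

Definition reach (P : program) (x : seq bool) (t : nat) (s s' : nat * memory) :
  Prop := exists2 t', t' <= t & iter t' (step P x) s = s'.

Lemma reach0 P x s : reach P x 0 s s.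
Proof. by exists 0. Qed.

Lemma reach_trans P x t1 t2 s1 s2 s3 :
  reach P x t1 s1 s2 -> reach P x t2 s2 s3 -> reach P x (t1 + t2) s1 s3.
Proof.
case=> u1 h1 <- [u2 h2 <-]; exists (u2 + u1); last by rewrite iterD.
by rewrite addnC leq_add.
Qed.

Lemma reach_leq P x t1 t2 s1 s2 :
  t1 <= t2 -> reach P x t1 s1 s2 -> reach P x t2 s1 s2.
Proof. by move=> h [u hu e]; exists u => //; apply: leq_trans h. Qed.

Lemma reach1 P x l ins mem :
  code_at P l [:: ins] -> reach P x 1 (l, mem) (exec x ins (l, mem)).
Proof.
case=> pre [post [-> h]]; exists 1 => //=; rewrite /step /= !size_cat /=.
by rewrite -h nth_cat ltnn subnn /= ifT //; lia.
Qed.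

Lemma reach_cons P x l ins code mem t s :
  code_at P l (ins :: code) ->
  (code_at P l.+1 code -> reach P x t (exec x ins (l, mem)) s) ->
  reach P x t.+1 (l, mem) s.
Proof.
rewrite -cat1s => h hr; rewrite -add1n.
apply: reach_trans (reach1 x mem (code_at_catl h)) _.
by apply: hr; have := code_at_catr h; rewrite addn1.
Qed.

Definition agree (d : nat) (mem mem' : memory) : Prop :=
  forall a, (forall t, d <= t -> a <> tmp t) -> mem' a = mem a.

Lemma agree_trans d d1 d2 m1 m2 m3 : d <= d1 -> d <= d2 ->
  agree d1 m1 m2 -> agree d2 m2 m3 -> agree d m1 m3.
Proof.
move=> h1 h2 a1 a2 a ha; rewrite a2 ?a1 // => t ht; apply: ha;
by [apply: leq_trans h2 ht|apply: leq_trans h1 ht].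
Qed.

Lemma agree_upd d m t k : d <= t -> agree d m (upd m (tmp t) k).
Proof. by move=> h a ha; rewrite /upd; case: eqP => // e; case: (ha t). Qed.

Definition models (s : state) (mem : memory) : Prop :=
  (forall v, mem (reg v) = sv s v) /\
  (forall a i, a < 8 -> mem (cell a i) = av s a i).

Lemma models_agree d s m m' : models s m -> agree d m m' -> models s m'.
Proof.
case=> h1 h2 ha; split=> [v|a i la]; rewrite ha ?h1 ?h2 // => t _;
by rewrite /reg /cell /tmp; lia.
Qed.

Lemma agree_tmp d m m' t : agree d m m' -> t < d -> m' (tmp t) = m (tmp t).
Proof. by move=> h ht; apply: h => u hu; rewrite /tmp; lia. Qed.

Lemma addr_codeP P x l a d mem :
  code_at P l (addr_code a d) ->
  exists mem', [/\ reach P x 7 (l, mem) (l + 7, mem'),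
    mem' (tmp d) = cell a (mem (tmp d)) & agree d mem mem'].
Proof.
move=> h; eexists; split.
- do 7!(apply: reach_cons h _ => h /=).
  have -> : l + 7 = l.+4.+3 by lia.
  exact: reach0.
- rewrite /upd !eqxx /cell ifN; last by rewrite /tmp; lia.
  by lia.
- move=> b hb; rewrite /upd.
  have /eqP/negbTE -> : b <> tmp d by exact: hb.
  by have /eqP/negbTE -> : b <> tmp d.+1 by apply: hb.
Qed.

Lemma cexpP P x l d e s mem :
  wfe e -> code_at P l (cexp e d) -> models s mem ->
  exists mem', [/\ reach P x (esize e) (l, mem) (l + esize e, mem'),
    mem' (tmp d) = evale x s e & agree d mem mem'].
Proof.
have bin e1 e2 (op : nat -> nat -> nat -> instr) (f : nat -> nat -> nat) :
  (forall l d mem, wfe e1 -> code_at P l (cexp e1 d) -> models s mem ->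
    exists mem', [/\ reach P x (esize e1) (l, mem) (l + esize e1, mem'),
    mem' (tmp d) = evale x s e1 & agree d mem mem']) ->
  (forall l d mem, wfe e2 -> code_at P l (cexp e2 d) -> models s mem ->
    exists mem', [/\ reach P x (esize e2) (l, mem) (l + esize e2, mem'),
    mem' (tmp d) = evale x s e2 & agree d mem mem']) ->
  (forall l mem a b c, exec x (op a b c) (l, mem) =
     (l.+1, upd mem a (f (mem b) (mem c)))) ->
  forall l d mem, wfe e1 && wfe e2 ->
  code_at P l (cexp e1 d ++ cexp e2 d.+1 ++ [:: op (tmp d) (tmp d) (tmp d.+1)])
  -> models s mem ->
  exists mem', [/\ reach P x (esize e1 + esize e2).+1 (l, mem)
      (l + (esize e1 + esize e2).+1, mem'),
    mem' (tmp d) = f (evale x s e1) (evale x s e2) & agree d mem mem'].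
- move=> {l d mem} h1 h2 hop l d mem /andP[w1 w2] hc hm.
  have [m1 [r1 v1 a1]] := h1 _ _ _ w1 (code_at_catl hc) hm.
  move/code_at_catr: hc; rewrite size_cexp => hc.
  have [m2 [r2 v2 a2]] := h2 _ _ _ w2 (code_at_catl hc) (models_agree hm a1).
  move/code_at_catr: hc; rewrite size_cexp => hc.
  exists (upd m2 (tmp d) (f (evale x s e1) (evale x s e2))); split.
  + rewrite addnS addnA -addn1; apply: reach_trans (reach_trans r1 r2) _.
    by have := reach1 x m2 hc; rewrite hop v2 (agree_tmp a2) // v1.
  + by rewrite /upd eqxx.
  + have a12 := agree_trans (leqnn d) (leqnSn d) a1 a2.
    exact: (agree_trans (leqnn d) (leqnn d) a12 (agree_upd _ _ (leqnn d))).
elim: e l d mem => [k|v|e1 h1 e2 h2|e1 h1 e2 h2|e1 h1|a e1 h1|e1 h1] l d mem /=.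
- move=> _ hc hm; exists (upd mem (tmp d) k).
  have := reach1 x mem hc; rewrite /= addn1 => r; split=> //.
    by rewrite /upd eqxx.
  exact: agree_upd.
- move=> _ hc hm; exists (upd mem (tmp d) (sv s v)).
  have := reach1 x mem hc; rewrite /= addn1 (proj1 hm) => r; split=> //.
    by rewrite /upd eqxx.
  exact: agree_upd.
- exact: (bin _ _ Add addn).
- exact: (bin _ _ Defs.Sub subn).
- move=> w hc hm; have [m1 [r1 v1 a1]] := h1 _ _ _ w (code_at_catl hc) hm.
  move/code_at_catr: hc; rewrite size_cexp => hc.
  exists (upd m1 (tmp d) (evale x s e1)./2); split.
  + rewrite addnS -addn1; apply: reach_trans r1 _.
    by have := reach1 x m1 hc; rewrite /= v1.
  + by rewrite /upd eqxx.
  + exact: (agree_trans (leqnn d) (leqnn d) a1 (agree_upd _ _ (leqnn d))).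
- move=> /andP[la w] hc hm.
  have [m1 [r1 v1 a1]] := h1 _ _ _ w (code_at_catl hc) hm.
  move/code_at_catr: hc; rewrite size_cexp => hc.
  have [m2 [r2 v2 a2]] := addr_codeP x m1
    (@code_at_catl _ _ (addr_code a d) _ hc).
  move/(@code_at_catr _ _ (addr_code a d)): hc => hc.
  have a12 : agree d mem m2 by exact: (agree_trans (leqnn d) (leqnn d) a1 a2).
  exists (upd m2 (tmp d) (av s a (evale x s e1))); split.
  + have -> : esize e1 + 8 = esize e1 + 7 + 1 by lia.
    rewrite !addnA; apply: reach_trans (reach_trans r1 r2) _.
    have := reach1 x m2 hc; rewrite /= v2 v1 addn1.
    by rewrite (proj2 (models_agree hm a12)).
  + by rewrite /upd eqxx.
  + exact: (agree_trans (leqnn d) (leqnn d) a12 (agree_upd _ _ (leqnn d))).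
- move=> w hc hm; have [m1 [r1 v1 a1]] := h1 _ _ _ w (code_at_catl hc) hm.
  move/code_at_catr: hc; rewrite size_cexp => hc.
  exists (upd m1 (tmp d) (nth false x (evale x s e1))); split.
  + rewrite addnS -addn1; apply: reach_trans r1 _.
    by have := reach1 x m1 hc; rewrite /= v1.
  + by rewrite /upd eqxx.
  + exact: (agree_trans (leqnn d) (leqnn d) a1 (agree_upd _ _ (leqnn d))).
Qed.

Lemma models_setv s mem v k :
  models s mem -> models (setv s v k) (upd mem (reg v) k).
Proof.
case=> h1 h2; split=> [u|a i la]; rewrite /upd /=.
  rewrite /upd -h1 (_ : (reg u == reg v) = (u == v)) //.
  by apply/eqP/eqP; rewrite /reg; lia.
by rewrite ifN ?h2 //; apply/eqP; rewrite /cell /reg; lia.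
Qed.

Lemma models_seta s mem a i k : a < 8 ->
  models s mem -> models (seta s a i k) (upd mem (cell a i) k).
Proof.
move=> la [h1 h2]; split=> [u|b j lb]; rewrite /upd /=.
  by rewrite ifN ?h1 //; apply/eqP; rewrite /cell /reg; lia.
case: (eqVneq b a) => [->|nab].
  rewrite /upd (_ : (cell a j == cell a i) = (j == i)) ?h2 //.
  by apply/eqP/eqP; rewrite /cell; lia.
by rewrite ifN ?h2 //; move/eqP: nab => nab; apply/eqP; rewrite /cell; lia.
Qed.

(** Unlike an expression, a command changes variables and cells; what enclosing loops rely on is
    only that their bounds and counters, stored in lower temporaries, survive. *)
Definition keeps_tmp (d : nat) (mem mem' : memory) : Prop :=
  forall t, t < d -> mem' (tmp t) = mem (tmp t).

Lemma agree_keeps d m m' : agree d m m' -> keeps_tmp d m m'.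
Proof. by move=> h t ht; apply: agree_tmp ht. Qed.

Lemma keeps_trans d m1 m2 m3 :
  keeps_tmp d m1 m2 -> keeps_tmp d m2 m3 -> keeps_tmp d m1 m3.
Proof. by move=> h1 h2 t ht; rewrite h2 ?h1. Qed.

Lemma keeps_leq d d' m1 m2 : d <= d' -> keeps_tmp d' m1 m2 -> keeps_tmp d m1 m2.
Proof. by move=> h1 h2 t ht; rewrite h2 //; apply: leq_trans h1. Qed.

Lemma keeps_reg d m v k : keeps_tmp d m (upd m (reg v) k).
Proof. by move=> t ht; rewrite /upd ifN //; rewrite /reg /tmp; lia. Qed.

Lemma keeps_cell d m a i k : keeps_tmp d m (upd m (cell a i) k).
Proof. by move=> t ht; rewrite /upd ifN //; rewrite /cell /tmp; lia. Qed.

Lemma ccmdP P x c l d s mem :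
  wfc c -> code_at P l (ccmd c l d) -> models s mem ->
  exists mem', [/\ reach P x (cost x c s) (l, mem) (l + csize c, mem'),
    models (eval x c s) mem' & keeps_tmp d mem mem'].
Proof.
elim: c l d s mem => [v e|a e1 e2|c1 h1 c2 h2|e c1 h1 c2 h2|v e c1 h1] l d s mem /=.
- move=> w hc hm; have [m1 [r1 v1 a1]] := cexpP x w (code_at_catl hc) hm.
  move/code_at_catr: hc; rewrite size_cexp => hc.
  exists (upd m1 (reg v) (evale x s e)); split.
  + rewrite addnS -addn1; apply: reach_trans r1 _.
    by have := reach1 x m1 hc; rewrite /= v1.
  + exact/models_setv/(models_agree hm a1).
  + exact: (keeps_trans (agree_keeps a1) (keeps_reg _ _ _)).
- move=> /and3P[la w1 w2] hc hm.
  have [m1 [r1 v1 a1]] := cexpP x w1 (code_at_catl hc) hm.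
  move/code_at_catr: hc; rewrite size_cexp => hc.
  have [m2 [r2 v2 a2]] := addr_codeP x m1
    (@code_at_catl _ _ (addr_code a d) _ hc).
  move/(@code_at_catr _ _ (addr_code a d)): hc => hc.
  have a12 : agree d mem m2 by exact: (agree_trans (leqnn d) (leqnn d) a1 a2).
  have hm2 := models_agree hm a12.
  have [m3 [r3 v3 a3]] := cexpP x w2 (code_at_catl hc) hm2.
  move/code_at_catr: hc; rewrite size_cexp => hc.
  exists (upd m3 (cell a (evale x s e1)) (evale x s e2)); split.
  + have -> : esize e1 + esize e2 + 8 = esize e1 + 7 + esize e2 + 1 by lia.
    apply: reach_trans (reach_trans (reach_trans r1 r2) r3) _.
    have := reach1 x m3 hc; rewrite /= v3 (agree_tmp a3) // v2 v1.
    by rewrite !addnA addn1.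
  + exact/models_seta/(models_agree hm2 a3).
  + have k3 := keeps_leq (leqnSn d) (agree_keeps a3).
    apply: (keeps_trans (keeps_trans (agree_keeps a12) k3)).
    exact: keeps_cell.
- move=> /andP[w1 w2] hc hm.
  have [m1 [r1 hm1 k1]] := h1 _ _ _ _ w1 (code_at_catl hc) hm.
  move/code_at_catr: hc; rewrite size_ccmd => hc.
  have [m2 [r2 hm2 k2]] := h2 _ _ _ _ w2 hc hm1.
  exists m2; split=> //; last exact: (keeps_trans k1 k2).
  by rewrite addnA; apply: reach_trans r1 r2.
- move=> /and3P[w w1 w2] hc hm.
  have [m0 [r0 v0 a0]] := cexpP x w (code_at_catl hc) hm.
  have hm0 := models_agree hm a0.
  move/code_at_catr: hc; rewrite size_cexp => hc.
  have rj := reach1 x m0 (@code_at_catl _ _ [:: _] _ hc).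
  move/(@code_at_catr _ _ [:: _]): hc => hc.
  have hc1 := code_at_catl hc.
  move/code_at_catr: hc; rewrite size_ccmd [size _]/= => hc.
  have hce := hc.
  move/(@code_at_catr _ _ [:: _; _]): hc; rewrite [size _]/= => hc2.
  have {}r0 := reach_trans r0 rj; move: r0; rewrite /= v0.
  case: eqP => [e0|ne0] /= r0.
    have [m2 [r2 hm2 k2]] := h2 _ _ _ _ w2 hc2 hm0.
    exists m2; split=> //; last exact: (keeps_trans (agree_keeps a0) k2).
    apply: reach_leq (reach_trans r0 _); last first.
      have -> : l + (esize e + csize c1 + csize c2 + 3) =
        l + esize e + 1 + csize c1 + 2 + csize c2 by lia.
      exact: r2.
    by lia.
  have [m1 [r1 hm1 k1]] := h1 _ _ _ _ w1 hc1 hm0.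
  exists (upd m1 (tmp d) 0); split.
  + apply: (@reach_leq _ _ (esize e + 1 + (cost x c1 s + 2))); first by lia.
    rewrite -[(l + esize e).+1]addn1 in r0.
    apply: reach_trans r0 _; apply: reach_trans r1 _.
    do 2!(apply: reach_cons hce _ => hce /=).
    rewrite /upd eqxx /=.
    have -> : l + (esize e + csize c1 + csize c2 + 3) =
        l + esize e + 1 + csize c1 + 2 + csize c2 by lia.
    exact: reach0.
  + exact/(models_agree hm1 (agree_upd m1 0 (leqnn d))).
  + apply: (keeps_trans (keeps_trans (agree_keeps a0) k1)).
    exact/agree_keeps/agree_upd.
- move=> /andP[w w1] hc hm.
  have [m0 [r0 v0 a0]] := cexpP x w (code_at_catl hc) hm.
  have hm0 := models_agree hm a0.
  move/code_at_catr: hc; rewrite size_cexp => hc.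
  set n := evale x s e in v0 *.
  set st := fun i => iteri i (fun j s' => eval x c1 (setv s' v j)) s.
  set top := l + esize e + 1 in hc *.
  have rc := reach1 x m0 (@code_at_catl _ _ [:: _] _ hc).
  move/(@code_at_catr _ _ [:: _]): hc; rewrite [size _]/= -/top => hc.
  have hct := hc.
  move/(@code_at_catr _ _ [:: _; _; _]): hc; rewrite [size _]/= => hc.
  have hc1 := code_at_catl hc.
  move/code_at_catr: hc; rewrite size_ccmd => hce.
  move: rc; rewrite /= -[(l + esize e).+1]addn1 -/top => rc.
  (* The situation at [top] after [k] iterations, counted from the moment at which the counter has
     been reset. *)
  have loop k : k <= n -> exists mem', [/\
      reach P x (\sum_(i < k) (cost x c1 (setv (st i) v i) + 7))
        (top, upd m0 (tmp d.+1) 0) (top, mem'),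
      models (st k) mem', keeps_tmp d m0 mem', mem' (tmp d) = n &
      mem' (tmp d.+1) = k].
    elim: k => [_|i IH lin].
      exists (upd m0 (tmp d.+1) 0); rewrite big_ord0; split.
      + exact: reach0.
      + exact: (models_agree hm0 (agree_upd m0 0 (leqnSn d))).
      + exact/agree_keeps/(agree_upd m0 0 (leqnSn d)).
      + by rewrite /upd ifN // /tmp; lia.
      + by rewrite /upd eqxx.
    have [mi [ri hmi ki vi ci]] := IH (ltnW lin).
    set mb := upd (upd mi (tmp d.+2) (n - i)) (reg v) i.
    have hmb : models (setv (st i) v i) mb.
      apply: models_setv; apply: (models_agree hmi).
      by apply: (@agree_upd d); lia.
    have [m' [r' hm' k']] := h1 _ _ _ _ w1 hc1 hmb.
    exists (upd (upd (upd m' (tmp d.+2) 1) (tmp d.+1) i.+1) (tmp d.+2) 0).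
    have vd : m' (tmp d) = n.
      rewrite k'; last by lia.
      by rewrite /mb /upd !ifN // /tmp /reg; lia.
    have vd1 : m' (tmp d.+1) = i.
      rewrite k'; last by lia.
      by rewrite /mb /upd !ifN // /tmp /reg; lia.
    split.
    + rewrite big_ord_recr /=; apply: reach_trans ri _.
      have -> : cost x c1 (setv (st i) v i) + 7 =
        3 + (cost x c1 (setv (st i) v i) + 4) by lia.
      apply: (reach_trans (s2 := (top + 3, mb))).
        move: hct; rewrite -!cat_cons => hct.
        do 2!(apply: reach_cons hct _ => hct /=).
        have vt : upd mi (tmp d.+2) (mi (tmp d) - mi (tmp d.+1)) (tmp d.+2) =
            n - i by rewrite /upd eqxx vi ci.
        rewrite vt vi ci ifN; last by lia.
        apply: reach_cons hct _ => _ /=.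
        rewrite /mb {3}/upd ifN; last by rewrite /tmp; lia.
        by rewrite ci addn3; exact: reach0.
      apply: reach_trans r' _.
      do 4!(apply: reach_cons hce _ => hce /=).
      set m1 := upd m' (tmp d.+2) 1.
      have -> : m1 (tmp d.+1) = i by rewrite /m1 /upd ifN // /tmp; lia.
      have -> : m1 (tmp d.+2) = 1 by rewrite /m1 /upd eqxx.
      rewrite addn1 ifT; first exact: reach0.
      by rewrite /upd eqxx.
    + apply: (models_agree hm'); apply: (agree_trans (leqnn d) (leqnn d)
        (agree_trans (leqnn d) (leqnn d) (agree_upd _ _ _) (agree_upd _ _ _))
        (agree_upd _ _ _)); lia.
    + move=> t ht; rewrite /upd !ifN; try by rewrite /tmp; lia.
      rewrite k'; last by lia.
      by rewrite /mb /upd !ifN ?ki // /tmp /reg; lia.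
    + by rewrite /upd !ifN ?vd // /tmp; lia.
    + by rewrite /upd eqxx !ifN // /tmp; lia.
  have [mn [rn hmn kn vn cn]] := loop n (leqnn n).
  exists (upd mn (tmp d.+2) 0); split.
  + have tE (S : nat) : esize e + 1 + (S + 2) <= esize e + 3 + S by lia.
    apply: (reach_leq (tE _)).
    apply: reach_trans (reach_trans r0 rc) _; apply: reach_trans rn _.
    move: hct; rewrite -!cat_cons => hct.
    do 2!(apply: reach_cons hct _ => hct /=).
    rewrite vn cn subnn /upd eqxx /=.
    have -> : l + (esize e + csize c1 + 8) = top + csize c1 + 7.
      by rewrite /top; lia.
    exact: reach0.
  + by apply: (models_agree hmn); apply: (@agree_upd d); lia.
  + move=> t ht; rewrite /upd ifN; last by rewrite /tmp; lia.
    by rewrite kn // (agree_tmp a0).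
Qed.

Definition compile (c : cmd) : program := ccmd c 0 0.

Definition start (x : seq bool) : state :=
  State (upd (fun=> 0) 0 (size x)) (fun _ _ => 0).

Lemma iter_step_halted P x s t : size P <= s.1 -> iter t (step P x) s = s.
Proof.
by move=> h; elim: t => //= t ->; rewrite /step ltnNge h.
Qed.

(** [outputs_within] inspects the configuration after exactly [t] steps; halted configurations are
    fixed points, so any upper bound on the cost will do. *)
Lemma compileP x c t : wfc c -> cost x c (start x) <= t ->
  outputs_within (compile c) x t (sv (eval x c (start x)) 0).
Proof.
move=> w ht.
have hc : code_at (compile c) 0 (ccmd c 0 0).
  by exists [::], [::]; rewrite cats0.
have hm : models (start x) (init x).2.
  split=> [v|a i la] /=; rewrite /upd.
    by case: v.
  by rewrite ifN // /cell; lia.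
have [mem [[t' lt' r] hm' _]] := ccmdP x w hc hm.
rewrite /outputs_within -(subnK (leq_trans lt' ht)) iterD.
rewrite [iter t' _ _]r iter_step_halted; last by rewrite /= size_ccmd.
by rewrite /= size_ccmd; split=> //; rewrite -(proj1 hm').
Qed.

(** * Frames and running times *)

Fixpoint modv (c : cmd) : seq nat :=
  match c with
  | Assign v _ => [:: v]
  | AStore _ _ _ => [::]
  | Seq c1 c2 | If _ c1 c2 => modv c1 ++ modv c2
  | For v _ c1 => v :: modv c1
  end.

Fixpoint moda (c : cmd) : seq nat :=
  match c with
  | Assign _ _ => [::]
  | AStore a _ _ => [:: a]
  | Seq c1 c2 | If _ c1 c2 => moda c1 ++ moda c2
  | For _ _ c1 => moda c1
  end.

Lemma eval_framev x c s v : v \notin modv c -> sv (eval x c s) v = sv s v.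
Proof.
elim: c s => [u e|a e1 e2|c1 h1 c2 h2|e c1 h1 c2 h2|u e c1 h1] s //=.
- by rewrite inE /upd => /negbTE ->.
- by rewrite mem_cat negb_or => /andP[w1 w2]; rewrite h2 ?h1.
- by rewrite mem_cat negb_or => /andP[w1 w2]; case: ifP => _; [apply: h1|apply: h2].
- rewrite inE negb_or => /andP[w w1].
  by elim: (evale x s e) => //= i IH; rewrite h1 //= /upd (negbTE w).
Qed.

Lemma eval_framea x c s a : a \notin moda c -> av (eval x c s) a = av s a.
Proof.
elim: c s => [u e|b e1 e2|c1 h1 c2 h2|e c1 h1 c2 h2|u e c1 h1] s //=.
- by rewrite inE => /negbTE ->.
- by rewrite mem_cat negb_or => /andP[w1 w2]; rewrite h2 ?h1.
- by rewrite mem_cat negb_or => /andP[w1 w2]; case: ifP => _; [apply: h1|apply: h2].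
- by move=> w1; elim: (evale x s e) => //= i IH; rewrite h1.
Qed.

(** A syntactic criterion for polynomial time: loops run only up to variables of [lv], and these
    never change, so a bound on their initial values limits every loop, however nested. *)
Fixpoint bounded_by (lv : seq nat) (c : cmd) : bool :=
  match c with
  | Assign v _ => v \notin lv
  | AStore _ _ _ => true
  | Seq c1 c2 | If _ c1 c2 => bounded_by lv c1 && bounded_by lv c2
  | For v (EVar u) c1 => [&& v \notin lv, u \in lv & bounded_by lv c1]
  | For _ _ _ => false
  end.

(** Chosen so that in [cost_leq] every sum of two powers of N is absorbed by one extra factor N, and
    every constant k by N^k. *)
Fixpoint degree (c : cmd) : nat :=
  match c with
  | Assign _ e => (esize e).+1
  | AStore _ e1 e2 => esize e1 + esize e2 + 8
  | Seq c1 c2 => (degree c1 + degree c2).+1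
  | If e c1 c2 => degree c1 + degree c2 + esize e + 4
  | For _ e c1 => degree c1 + esize e + 9
  end.

Lemma bounded_modv lv c v : bounded_by lv c -> v \in lv -> v \notin modv c.
Proof.
move=> h hv; elim: c h => [u e|b e1 e2|c1 h1 c2 h2|e c1 h1 c2 h2|u e c1 h1] //=.
- by rewrite inE; apply: contraNN => /eqP <-.
- by move=> /andP[w1 w2]; rewrite mem_cat negb_or h1 ?h2.
- by move=> /andP[w1 w2]; rewrite mem_cat negb_or h1 ?h2.
- case: e => // w /and3P[nu _ w1]; rewrite inE negb_or h1 // andbT.
  by apply: contraNN nu => /eqP <-.
Qed.

Lemma expn_add_leq N a b : 1 < N -> N ^ a + N ^ b <= N ^ (a + b).+1.
Proof.
move=> hN; rewrite expnS.
have ha : N ^ a <= N ^ (a + b) by rewrite leq_exp2l // leq_addr.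
have hb : N ^ b <= N ^ (a + b) by rewrite leq_exp2l // leq_addl.
apply: leq_trans (leq_add ha hb) _; rewrite addnn -muln2 mulnC leq_mul2r.
by rewrite hN orbT.
Qed.

Lemma leq_expn_self N k : 1 < N -> k <= N ^ k.
Proof. by move=> hN; apply/ltnW/ltn_expl. Qed.

Lemma cost_leq x lv c s N : 1 < N -> bounded_by lv c ->
  (forall v, v \in lv -> sv s v <= N) -> cost x c s <= N ^ degree c.
Proof.
move=> hN; elim: c s => [u e|b e1 e2|c1 h1 c2 h2|e c1 h1 c2 h2|u e c1 h1] s //=.
- by move=> _ _; apply: leq_expn_self.
- by move=> _ _; apply: leq_expn_self.
- move=> /andP[w1 w2] hs; apply: leq_trans (expn_add_leq _ _ hN).
  apply: leq_add; first exact: h1.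
  by apply: h2 => // v hv; rewrite eval_framev ?hs // (bounded_modv w1).
- move=> /andP[w1 w2] hs.
  have -> : degree c1 + degree c2 + esize e + 4 =
    (esize e + 3 + (degree c1 + degree c2)).+1 by lia.
  apply: leq_trans (expn_add_leq _ _ hN).
  apply: leq_add; first exact: leq_expn_self.
  case: ifP => _.
    by apply: leq_trans (h1 _ w1 hs) _; rewrite leq_exp2l // leq_addr.
  by apply: leq_trans (h2 _ w2 hs) _; rewrite leq_exp2l // leq_addl.
- case: e => // w /and3P[nu hw w1] hs /=.
  have -> : degree c1 + 1 + 9 = (1 + 3 + (degree c1 + 5)).+1 by lia.
  apply: leq_trans (expn_add_leq _ _ hN).
  apply: leq_add; first exact: leq_expn_self.
  have -> : degree c1 + 5 = (degree c1 + 3).+1.+1 by lia.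
  rewrite expnS; apply: (@leq_trans (\sum_(i < sv s w) N ^ (degree c1 + 3).+1)).
    apply: leq_sum => i _; apply: leq_trans (expn_add_leq _ _ hN).
    apply: leq_add; last first.
      (* The overhead of 7 steps per iteration is paid by N^3. *)
      have : 2 ^ 3 <= N ^ 3 by rewrite leq_exp2r.
      by apply: leq_trans.
    apply: h1 => // v hv /=; rewrite /upd ifN; last first.
      by apply: contraNN nu => /eqP <-.
    suff -> : forall j, sv (iteri j (fun j s' => eval x c1 (setv s' u j)) s) v =
      sv s v.
      exact: hs.
    elim=> //= j IH; rewrite eval_framev ?(bounded_modv w1) //= /upd ifN //.
    by apply: contraNN nu => /eqP <-.
  by rewrite sum_nat_const card_ord leq_mul2r hs ?orbT.
Qed.

(** * Zero-sum partitions *)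

(** The one-dimensional Steinitz argument: as the total is zero, a nonzero partial sum leaves some
    element of the opposite sign, and appending it keeps the partial sum within [-L, L]. *)
Lemma bounded_prefix_order (T : eqType) (val : T -> int) (L : nat) (s : seq T) k :
  (forall t, t \in s -> `|val t| <= L)%R -> (\sum_(t <- s) val t = 0)%R ->
  k <= size s ->
  exists p q, [/\ perm_eq (p ++ q) s, size p = k &
    forall i, i <= k -> (`|\sum_(t <- take i p) val t| <= L)%R].
Proof.
move=> hb h0; elim: k => [_|k IH lk].
  by exists [::], s; split=> // i _; rewrite big_nil.
have [p [q [pq sp hp]]] := IH (ltnW lk).
have pq0 : (\sum_(t <- p) val t + \sum_(t <- q) val t = 0)%R.
  by rewrite -big_cat (perm_big _ pq).
have qn : q != [::].
  apply/eqP => q0; move/perm_size: pq; rewrite q0 cats0 sp => e.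
  by rewrite -e ltnn in lk.
have hpk : (`|\sum_(t <- p) val t| <= L)%R.
  by have := hp k (leqnn k); rewrite -sp take_size.
have [t tq ht] : exists2 t, t \in q &
    (`|\sum_(t <- p) val t + val t| <= L)%R.
  have inb t : t \in q -> (`|val t| <= L)%R.
    by move=> tq; apply: hb; rewrite -(perm_mem pq) mem_cat tq orbT.
  have [sp0|sp0|sp0] := ltgtP (\sum_(t <- p) val t)%R 0%R.
  - case: (boolP (has (fun t => 0 < val t)%R q)) => [/hasP[t tq vt]|/hasPn hn].
      by exists t => //; have := inb t tq; lia.
    suff : (\sum_(t <- q) val t <= 0)%R by lia.
    rewrite big_seq; apply: sumr_le0 => t /hn; lia.
  - case: (boolP (has (fun t => val t < 0)%R q)) => [/hasP[t tq vt]|/hasPn hn].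
      by exists t => //; have := inb t tq; lia.
    suff : (0 <= \sum_(t <- q) val t)%R by lia.
    rewrite big_seq; apply: sumr_ge0 => t /hn; lia.
  - case: q qn {pq pq0} inb => // t q _ inb; exists t; first exact: mem_head.
    by rewrite sp0 add0r inb ?mem_head.
exists (rcons p t), (rem t q); split.
- rewrite cat_rcons; apply: perm_trans pq.
  by rewrite perm_cat2l perm_sym perm_to_rem.
- by rewrite size_rcons sp.
move=> i; rewrite leq_eqVlt => /orP[/eqP ->|ik].
  by rewrite -sp -(size_rcons p t) take_size -cats1 big_cat /= big_seq1.
by rewrite -cats1 takel_cat ?sp //; apply: hp.
Qed.

(** In a long sequence, 2L + 2 consecutive partial sums, including the empty one, take at most 2L +
    1 values. Two of them coincide, the nonempty segment between them is a balanced block, and the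
    rest is split recursively. *)
Lemma zero_sum_partition1 (T : eqType) (val : T -> int) (L : nat) (s : seq T) :
  (forall t, t \in s -> `|val t| <= L)%R -> (\sum_(t <- s) val t = 0)%R ->
  exists ss : seq (seq T), perm_eq (flatten ss) s /\
    forall b, b \in ss ->
      size b <= (2 * L).+1 /\ (\sum_(t <- b) val t = 0)%R.
Proof.
have [N] := ubnP (size s); elim: N s => // N IH s sN hb h0.
have [small|big] := leqP (size s) (2 * L).+1.
  exists [:: s]; rewrite /= cats0; split=> // b.
  by rewrite inE => /eqP ->.
have [p [q [pq sp hp]]] := bounded_prefix_order hb h0 (ltnW big).
(* Adding L moves the partial sums from [-L, L] into the ordinals. *)
pose f (i : 'I_(2 * L).+2) : 'I_(2 * L).+1 :=
  inord (absz (\sum_(t <- take i p) val t + L%:Z)%R).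
have [i [j [ij fij]]] : exists i j : 'I_(2 * L).+2, i < j /\ f i = f j.
  have /injectivePn[i [j nij fij]] : ~~ injectiveb f.
    apply/negP => /injectiveP /leq_card; rewrite !card_ord; lia.
  case: (ltngtP i j) => [h|h|h]; [by exists i, j|by exists j, i|].
  by move: nij; rewrite (val_inj h) eqxx.
have fE (k : 'I_(2 * L).+2) :
    nat_of_ord (f k) = absz (\sum_(t <- take k p) val t + L%:Z)%R.
  rewrite inordK //; have := hp k; rewrite -ltnS => /(_ (ltn_ord k)); lia.
have eqs : (\sum_(t <- take i p) val t = \sum_(t <- take j p) val t)%R.
  have /(congr1 (@nat_of_ord _)) := fij; rewrite !fE.
  have := hp i; rewrite -ltnS => /(_ (ltn_ord i)).
  have := hp j; rewrite -ltnS => /(_ (ltn_ord j)); lia.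
have jp : j <= size p by rewrite sp -ltnS.
pose b := drop i (take j p).
have bE : take j p = take i p ++ b.
  by rewrite -[LHS](cat_take_drop i) take_takel // ltnW.
have b0 : (\sum_(t <- b) val t = 0)%R.
  by apply: (addrI (\sum_(t <- take i p) val t)%R); rewrite -big_cat -bE addr0.
have sb : size b = j - i by rewrite size_drop size_takel.
pose r := take i p ++ drop j p ++ q.
have sP : perm_eq (b ++ r) s.
  apply: perm_trans pq; rewrite /r perm_catCA -[X in perm_eq _ (X ++
    _)](cat_take_drop j).
  by rewrite bE -!catA.
have rs t : t \in r -> t \in s.
  by move=> tr; rewrite -(perm_mem sP) mem_cat tr orbT.
have r0 : (\sum_(t <- r) val t = 0)%R.
  by move: h0; rewrite -(perm_big _ sP) big_cat /= b0 add0r.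
have lr : size r < N.
  by move/perm_size: sP; rewrite size_cat sb; lia.
have [ss [ssP hss]] := IH r lr (fun t tr => hb t (rs t tr)) r0.
exists (b :: ss); split.
  by apply: perm_trans sP; rewrite /= perm_cat2l.
move=> b'; rewrite inE => /orP[/eqP -> | /hss //]; split=> //.
by have := ltn_ord j; rewrite sb; lia.
Qed.

(** Blocks of size at most B have sums in [-B, B] in the next coordinate, so at most 2B + 1 of them
    are merged into a new block. *)
Fixpoint block_bound (m : nat) : nat :=
  if m is k.+1 then block_bound k * (2 * block_bound k).+1 else 1.

(* Grouping the blocks that are already balanced in the first coordinates turns
   one more coordinate into a one-dimensional problem. *)
Lemma zero_sum_partition (T : eqType) (m : nat) (vec : nat -> T -> int)
    (s : seq T) :
  (forall k t, k < m -> (`|vec k t| <= 1)%R) ->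
  (forall k, k < m -> (\sum_(t <- s) vec k t = 0)%R) ->
  exists ss : seq (seq T), perm_eq (flatten ss) s /\
    forall b, b \in ss -> size b <= block_bound m /\
      forall k, k < m -> (\sum_(t <- b) vec k t = 0)%R.
Proof.
elim: m => [|m IH] hb h0.
  exists [seq [:: t] | t <- s]; split; first by rewrite flatten_seq1.
  by move=> b /mapP[t _ ->].
have [ss [ssP hss]] := IH (fun k t lk => hb k t (ltnW lk))
  (fun k lk => h0 k (ltnW lk)).
pose val b := (\sum_(t <- b) vec m t)%R.
have [b bss||sss [sssP hsss]] := @zero_sum_partition1 _ val (block_bound m) ss.
- apply: le_trans (ler_norm_sum _ _ _) _.
  apply: (@le_trans _ _ (\sum_(t <- b) 1)%R).
    by apply: ler_sum => t _; apply: hb.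
  by rewrite big_const_seq iter_addr_0 count_predT; have [] := hss b bss; lia.
- by rewrite /val -big_flatten (perm_big _ ssP) h0.
exists [seq flatten bs | bs <- sss]; split.
  apply: perm_trans ssP; apply: perm_trans (perm_flatten sssP).
  by elim: sss {sssP hsss} => //= a l IHl; rewrite flatten_cat perm_cat2l.
move=> b /mapP[bs bsss ->]; have [sbs vbs] := hsss bs bsss.
have inss a : a \in bs -> a \in ss.
  move=> ha; rewrite -(perm_mem sssP); apply/flattenP.
  by exists bs.
split=> [/=|k].
  apply: (@leq_trans (\sum_(a <- bs) block_bound m)).
    rewrite size_flatten sumnE big_map [X in X <= _]big_seq [X in _ <= X]big_seq.
    by apply: leq_sum => a /inss /hss[].
  by rewrite big_const_seq iter_addn_0 count_predT leq_mul2l sbs orbT.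
rewrite ltnS leq_eqVlt => /orP[/eqP ->|lk].
  by rewrite big_flatten.
by rewrite big_flatten big_seq big1 // => a /inss /hss[_ ->].
Qed.

(** The recursion grows no faster than squaring: 4B (2B + 1) is at most (4B)^2 for B at least 1. One
    further squaring leaves room for the factor m. *)
Lemma block_bound_leq m : m * block_bound m <= 2 ^ (2 ^ m.+2).
Proof.
have h k : 4 * block_bound k <= 2 ^ (2 ^ k.+1).
  elim: k => //= k IH.
  have -> : 2 ^ (2 ^ k.+2) = 2 ^ (2 ^ k.+1) * 2 ^ (2 ^ k.+1).
    by rewrite -expnD addnn -mul2n -expnS.
  apply: leq_trans (leq_mul IH IH).
  have : 0 < block_bound k by elim: (k) => //= j hj; rewrite muln_gt0 hj.
  by nia.
have -> : 2 ^ (2 ^ m.+2) = 2 ^ (2 ^ m.+1) * 2 ^ (2 ^ m.+1).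
  by rewrite -expnD addnn -mul2n -expnS.
apply: leq_mul; last by have := h m; lia.
apply: leq_trans (ltnW (ltn_expl m (ltnSn 1))) _.
by rewrite leq_exp2l // expnS; have := ltn_expl m (ltnSn 1); lia.
Qed.

(** * Sensitivity of optimal covers *)

Definition symdiff (T : finType) (A B : {set T}) : {set T} :=
  [set j | (j \in A) (+) (j \in B)].

Lemma Posz_sum (I : Type) (r : seq I) (P : pred I) (F : I -> nat) :
  Posz (\sum_(i <- r | P i) F i) = (\sum_(i <- r | P i) Posz (F i))%R.
Proof. exact: (big_morph Posz PoszD). Qed.

(** Switching the membership of a part G of the difference in both sets adds to X exactly what it
    removes from Y. Used for coverage and for weight, this makes the exchange symmetric. *)
Lemma sum_symdiff (n : nat) (X Y G : {set 'I_n}) (f : 'I_n -> int) :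
  G \subset symdiff X Y ->
  (\sum_(j in symdiff X G) f j =
     \sum_(j in X) f j + \sum_(j in G) (if j \in Y then f j else - f j))%R /\
  (\sum_(j in symdiff Y G) f j =
     \sum_(j in Y) f j - \sum_(j in G) (if j \in Y then f j else - f j))%R.
Proof.
move=> /subsetP sG; rewrite -sumrN.
split; rewrite big_mkcond [X in _ = (X + _)%R]big_mkcond
  [X in _ = (_ + X)%R]big_mkcond -big_split; apply: eq_bigr => j _;
  rewrite !inE; have := sG j; rewrite !inE; case: (j \in G) => /=;
  case: (j \in X) => /=; case: (j \in Y) => /=; try (by move/(_ isT));
  by move=> _; rewrite ?addr0 ?add0r ?oppr0 ?addr0 ?subrr ?opprK ?addNr.
Qed.

Definition covered (n : nat) (bit : nat -> nat -> bool) (X : {set 'I_n})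
    (k : nat) : nat := \sum_(j in X) bit j k.

Definition total_weight (n : nat) (w : nat -> nat) (X : {set 'I_n}) : nat :=
  \sum_(j in X) w j.

Definition covers (n m : nat) (bit : nat -> nat -> bool) (b : nat -> nat)
    (X : {set 'I_n}) : Prop := forall k, k < m -> b k <= covered bit X k.

(* The difference of the two covers, completed by unit vectors for the change
   of the slacks and for the increase of the requirements, is a zero-sum family.
   The balanced blocks without an increase can be moved from Y to X, so they do
   not lower the cost and only the other blocks, at most m, are needed. *)
Lemma cover_sensitivity (n m : nat) (bit : nat -> nat -> bool) (w b b' : nat -> nat)
    (X Y : {set 'I_n}) :
  (forall k, k < m -> b k <= b' k <= (b k).+1) ->
  covers m bit b X -> (forall X' : {set 'I_n}, covers m bit b X' -> total_weight
    w X <= total_weight w X') ->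
  covers m bit b' Y ->
  exists Y' : {set 'I_n}, [/\ covers m bit b' Y', total_weight w Y' <=
    total_weight w Y &
    #|symdiff X Y'| <= m * block_bound m].
Proof.
move=> bb' cX oX cY.
(* Three kinds of vectors: sets in which X and Y differ, unit changes of the slack of an element,
   and unit increases of a requirement. *)
pose T := ('I_n + nat + nat)%type.
pose sl k := covered bit X k - b k; pose sl' k := covered bit Y k - b' k.
(* All slack vectors of one element have the same sign, so using only some of them leaves the slack
   between its two nonnegative end values. *)
pose sg (k : nat) : int := if sl k <= sl' k then (-1)%R else 1%R.
pose gap k := (sl' k - sl k) + (sl k - sl' k).
pose D := symdiff X Y.
pose sd (f : 'I_n -> int) j : int := if j \in Y then f j else (- f j)%R.
pose bi k (j : 'I_n) : int := Posz (bit j k).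
pose vec k (t : T) : int :=
  match t with
  | inl (inl j) => sd (bi k) j
  | inl (inr r) => if r == k then sg k else 0%R
  | inr r => if r == k then (-1)%R else 0%R
  end.
pose pj (t : T) : option 'I_n := if t is inl (inl j) then Some j else None.
pose spec (t : T) := if t is inr _ then true else false.
have vecsum k (l : seq T) : (\sum_(t <- l) vec k t =
    \sum_(j <- pmap pj l) sd (bi k) j +
    sg k * (count_mem (inl (inr k) : T) l)%:Z - (count_mem (inr k : T) l)%:Z)%R.
  elim: l => [|t l IH]; first by rewrite !big_nil mulr0.
  rewrite big_cons IH; case: t => [[j|r]|r] /=.
  - by rewrite big_cons -!addrA.
  - by rewrite (inj_eq (@inl_inj _ _)) (inj_eq (@inr_inj _ _)); case: eqP => /=
      _; lia.
  - by rewrite (inj_eq (@inr_inj _ _)); case: eqP => /= _; lia.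
pose s1 : seq T := [seq inl (inl j) | j <- enum D].
pose s2 : seq T := flatten [seq nseq (gap r) (inl (inr r)) | r <- iota 0 m].
pose s3 : seq T := [seq inr r | r <- iota 0 m & b r < b' r].
pose s := s1 ++ s2 ++ s3.
have pj2 : pmap pj s2 = [::].
  rewrite /s2; elim: (iota 0 m) => //= r l IH; rewrite pmap_cat IH cats0.
  by elim: (gap r).
have pj3 : pmap pj s3 = [::] by rewrite /s3; elim: [seq _ <- _ | _].
have pjs : pmap pj s = enum D.
  rewrite /s !pmap_cat pj2 pj3 !cats0 /s1.
  by elim: (enum D) => //= j l ->.
have c1 (t : T) : pj t = None -> count_mem t s1 = 0.
  by move=> ht; rewrite /s1; elim: (enum D) => //= j l ->; case: eqP ht => // <-.
have cs2 k : k < m -> count_mem (inl (inr k) : T) s = gap k.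
  move=> lk; rewrite /s !count_cat c1 // add0n.
  have -> : count_mem (inl (inr k) : T) s3 = 0.
    by rewrite /s3; elim: [seq _ <- _ | _].
  rewrite addn0 /s2 count_flatten -map_comp sumnE big_map.
  rewrite (eq_bigr (fun r => if r == k then gap k else 0)); last first.
    move=> r _ /=; rewrite count_nseq /= (inj_eq (@inl_inj _ _)) (inj_eq
      (@inr_inj _ _)).
    by case: eqP => [->|]; rewrite ?mul1n ?mul0n.
  have -> : iota 0 m = index_iota 0 m by rewrite /index_iota subn0.
  by rewrite -big_mkcond (big_nat1_eq _ (fun=> gap k)) lk.
have cs3 k : k < m -> count_mem (inr k : T) s = b' k - b k.
  move=> lk; rewrite /s !count_cat c1 // add0n.
  have -> : count_mem (inr k : T) s2 = 0.
    rewrite /s2; elim: (iota 0 m) => //= r l IH; rewrite count_cat IH addn0.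
    by rewrite count_nseq.
  rewrite add0n /s3 count_map (eq_count (a2 := pred1 k)); last first.
    by move=> r /=; rewrite (inj_eq (@inr_inj _ _)).
  rewrite count_uniq_mem ?filter_uniq ?iota_uniq // mem_filter mem_iota lk andbT.
  by have := bb' k lk; lia.
have XYsum k : (\sum_(j <- enum D) sd (bi k) j =
    (covered bit Y k)%:Z - (covered bit X k)%:Z)%R.
  have [e _] := @sum_symdiff _ X Y D (bi k) (subxx _).
  have eC (Z : {set 'I_n}) : Posz (covered bit Z k) = (\sum_(j in Z) bi k j)%R.
    exact: Posz_sum.
  move: e; rewrite big_enum !eC /D /=.
  have -> : symdiff X (symdiff X Y) = Y.
    by apply/setP=> j; rewrite !inE addKb.
  by move=> ->; rewrite addrC addKr.
have s0 k : k < m -> (\sum_(t <- s) vec k t = 0)%R.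
  move=> lk; rewrite vecsum pjs XYsum cs2 // cs3 //.
  have := cX k lk; have := cY k lk; have := bb' k lk.
  by rewrite /sg; case: (leqP (sl k)); rewrite /gap /sl /sl'; lia.
have vb k t : k < m -> (`|vec k t| <= 1)%R.
  move=> _; case: t => [[j|r]|r] /=.
  - by rewrite /sd /bi; case: (j \in Y); case: (bit j k).
  - by rewrite /sg; case: ifP => // _; case: ifP.
  - by case: ifP.
have [ss [ssP hss]] := zero_sum_partition vb s0.
pose bad := [seq c <- ss | has spec c].
pose good := [seq c <- ss | ~~ has spec c].
have gbP : perm_eq (flatten bad ++ flatten good) s.
  rewrite -flatten_cat; apply: perm_trans ssP.
  by apply: perm_flatten; rewrite (perm_filterC (has spec)).
have pbg : perm_eq (pmap pj (flatten bad) ++ pmap pj (flatten good)) (enum D).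
  by rewrite -pmap_cat -pjs perm_pmap.
set gl := pmap pj (flatten good) in pbg.
have ugl : uniq gl.
  by have := enum_uniq D; rewrite -(perm_uniq pbg) cat_uniq => /and3P[].
pose G := [set j in gl].
have sumG (f : 'I_n -> int) : (\sum_(j <- gl) f j = \sum_(j in G) f j)%R.
  by rewrite big_uniq //=; apply: eq_bigl => j; rewrite inE.
have GD : G \subset D.
  apply/subsetP => j; rewrite inE => jg.
  by rewrite -mem_enum -(perm_mem pbg) mem_cat jg orbT.
(* In the good blocks nothing but slack vectors can balance the change of coverage, and there are at
   most [gap k] of them. This is why both exchanged sets remain covers. *)
have covG k : k < m -> exists2 c, c <= gap k &
    (\sum_(j in G) sd (bi k) j = - (sg k * c%:Z))%R.
  move=> lk; exists (count_mem (inl (inr k) : T) (flatten good)).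
    rewrite -(cs2 k lk) -(permP gbP) count_cat; exact: leq_addl.
  have := vecsum k (flatten good); rewrite sumG.
  rewrite big_flatten big_seq big1 => [|c]; last first.
    by rewrite mem_filter => /andP[_ /hss[_ ->]].
  have -> : count_mem (inr k : T) (flatten good) = 0.
    apply/count_memPn/flattenP => -[c]; rewrite mem_filter => /andP[/hasPn hc _].
    by move=> /hc.
  by lia.
have [_ eYw] := sum_symdiff (fun j => Posz (w j)) GD.
have [eXw _] := sum_symdiff (fun j => Posz (w j)) GD.
have covXG : covers m bit b (symdiff X G).
  move=> k lk; have [c lc ec] := covG k lk.
  have [e _] := sum_symdiff (bi k) GD.
  have := cX k lk; have := cY k lk.
  have : Posz (covered bit (symdiff X G) k) =
      (Posz (covered bit X k) - sg k * c%:Z)%R.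
    by rewrite /covered !Posz_sum [LHS]e ec.
  by move: lc; rewrite /sg; case: (leqP (sl k)); rewrite /gap /sl /sl'; lia.
exists (symdiff Y G); split.
- move=> k lk; have [c lc ec] := covG k lk.
  have [_ e] := sum_symdiff (bi k) GD.
  have := cX k lk; have := cY k lk.
  have : Posz (covered bit (symdiff Y G) k) =
      (Posz (covered bit Y k) + sg k * c%:Z)%R.
    by rewrite /covered !Posz_sum [LHS]e ec opprK.
  by move: lc; rewrite /sg; case: (leqP (sl k)); rewrite /gap /sl /sl'; lia.
(* As X is optimal and X with G switched is still a cover, the signed weight of G is nonnegative;
   undoing G in Y cannot raise the weight. *)
- have := oX _ covXG; rewrite -!lez_nat /total_weight !Posz_sum eXw eYw.
  by rewrite lerDl gerBl.
- have -> : symdiff X (symdiff Y G) = D :\: G.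
    apply/setP => j; have := subsetP GD j; rewrite /D !inE.
    by case: (j \in gl) => [/(_ isT)|_]; case: (j \in X); case: (j \in Y).
  apply: (@leq_trans (size (pmap pj (flatten bad)))).
    apply: leq_trans (card_size _); apply: subset_leq_card; apply/subsetP => j.
    rewrite in_setD inE => /andP[/negbTE jg jD].
    by have := perm_mem pbg j; rewrite mem_cat jg orbF mem_enum jD.
  apply: (@leq_trans (size (flatten bad))).
    by rewrite size_pmap count_size.
  apply: (@leq_trans (size bad * block_bound m)).
    rewrite -[size bad]count_predT -sum1_count big_distrl /= size_flatten sumnE.
    rewrite big_map [X in X <= _]big_seq [X in _ <= X]big_seq; apply: leq_sum => c.
    by rewrite mul1n mem_filter => /andP[_ /hss[]].
  (* Every bad block holds a requirement increase, and [s3] has at most one for each element. *)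
  rewrite leq_mul2r; apply/orP; right.
  apply: (@leq_trans (count spec (flatten bad))).
    rewrite /bad; elim: ss {ssP hss gbP pbg gl ugl G sumG GD covG eYw eXw covXG
      bad good} => //= c l IH.
    by case: ifP => //= hc; rewrite count_cat -[_.+1]add1n leq_add // -has_count.
  apply: (@leq_trans (count spec s)).
    by rewrite -(permP gbP) count_cat leq_addr.
  have -> : count spec s = count spec s3.
    rewrite /s !count_cat.
    have -> : count spec s1 = 0 by rewrite /s1; elim: (enum D).
    have -> : count spec s2 = 0.
      rewrite /s2; elim: (iota 0 m) => //= r l IH.
      by rewrite count_cat IH count_nseq.
    by [].
  by apply: leq_trans (count_size _ _) _; rewrite /s3 size_map size_filter;
    apply: leq_trans (count_size _ _) _; rewrite size_iota.
Qed.

(** * Cheapest covers with given type counts *)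

(** Ties are broken by the index, so that ranks within a type are distinct and [select] can meet
    prescribed counts exactly. *)
Definition before (w : nat -> nat) (i j : nat) : bool :=
  (w i < w j) || (w i == w j) && (i < j).

Definition rank (n : nat) (w mask : nat -> nat) (j : nat) : nat :=
  \sum_(i < n) ((mask i == mask j) && before w i j).

Definition select (n : nat) (w mask c : nat -> nat) : {set 'I_n} :=
  [set j : 'I_n | rank n w mask j < c (mask j)].

Definition type_count (n : nat) (mask : nat -> nat) (J : {set 'I_n}) (t : nat) :
  nat := \sum_(j in J) (mask j == t).

Lemma rank_ltn n (w mask : nat -> nat) (i j : 'I_n) : mask i = mask j -> before
  w i j ->
  rank n w mask i < rank n w mask j.
Proof.
move=> mij bij; rewrite /rank (bigD1 i) //= [X in _ < X](bigD1 i) //=.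
have -> : before w i i = false by rewrite /before; lia.
rewrite mij eqxx bij /= -add1n leq_add2l -mij; apply: leq_sum => l _.
rewrite mij; case: eqP => //= _; move: bij; rewrite /before; lia.
Qed.

Lemma sum_nat_set (n : nat) (J : {set 'I_n}) (P : pred nat) :
  \sum_(j in J) P j = #|[set j in J | P (nat_of_ord j)]|.
Proof.
rewrite -sum1_card big_mkcond [RHS]big_mkcond /=; apply: eq_bigr => j _.
by rewrite inE; case: (j \in J) => //=; case: (P j).
Qed.

(** The ranks of the sets of type t are distinct and smaller than their number, hence they are 0, 1,
    2 and so on without gaps, and exactly c t of them lie below c t. *)
Lemma type_count_select n (w mask c : nat -> nat) t :
  c t <= type_count mask [set: 'I_n] t ->
  type_count mask (select n w mask c) t = c t.
Proof.
pose K := [set j : 'I_n | mask j == t].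
have KE : type_count mask [set: 'I_n] t = #|K|.
  rewrite /type_count (sum_nat_set _ (fun j => mask j == t)).
  by apply: eq_card => j; rewrite !inE.
rewrite KE => lc.
pose rk (j : 'I_n) := rank n w mask j.
have rk_inj : {in K &, injective rk}.
  move=> i j; rewrite !inE => /eqP mi /eqP mj e; apply/val_inj.
  have [] := ltngtP i j => //= lij.
  - have := @rank_ltn n w mask i j; have := @rank_ltn n w mask j i.
    by move: e; rewrite /rk mi mj /before; lia.
  - have := @rank_ltn n w mask i j; have := @rank_ltn n w mask j i.
    by move: e; rewrite /rk mi mj /before; lia.
have rk_lt j : j \in K -> rk j < #|K|.
  rewrite inE => /eqP mj; rewrite /rk /rank.
  have -> : #|K| = \sum_(i < n) (mask i == t).
    by rewrite -KE /type_count; apply: eq_bigl => i; rewrite inE.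
  rewrite (bigD1 j) //= [X in _ < X](bigD1 j) //= mj eqxx.
  have -> : before w j j = false by rewrite /before; lia.
  by rewrite add1n ltnS; apply: leq_sum => i _; case: (mask i == t) => //=;
    case: before.
have perm_rk : perm_eq (map rk (enum K)) (iota 0 #|K|).
  have u : uniq (map rk (enum K)).
    by rewrite map_inj_in_uniq ?enum_uniq // => i j; rewrite !mem_enum; apply:
      rk_inj.
  have sub : {subset map rk (enum K) <= iota 0 #|K|}.
    by move=> r /mapP[j]; rewrite mem_enum mem_iota => jK ->; apply: rk_lt.
  apply: uniq_perm => //; first exact: iota_uniq.
  apply: (uniq_min_size u sub _).2.
  by rewrite size_map size_iota -cardE.
transitivity (count (fun r => r < c t) (iota 0 #|K|)).
  rewrite -(permP perm_rk) count_map -sum1_count big_enum_cond /=.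
  rewrite /type_count big_mkcond [RHS]big_mkcond /=.
  apply: eq_bigr => j _; rewrite !inE /rk; case: eqP => [->|]; last first.
    by case: ifP.
  by case: ifP.
rewrite -(subnKC lc) iotaD count_cat.
rewrite (_ : count _ (iota 0 (c t)) = c t); last first.
  by rewrite -[RHS](size_iota 0); apply/eqP; rewrite -all_count; apply/allP => r;
     rewrite mem_iota.
rewrite (_ : count _ _ = 0) ?addn0 //; apply/eqP; rewrite -leqn0 leqNgt -has_count.
by apply/hasPn => r; rewrite mem_iota -leqNgt => /andP[].
Qed.

(** Without their common part the two sets still have equal size, and the largest weight in A \ B
    separates the weights there from those in B \ A. *)
Lemma leq_sum_exchange (T : finType) (w : T -> nat) (A B : {set T}) :
  #|A| = #|B| -> (forall i j, i \in A -> j \in B -> j \notin A -> w i <= w j) ->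
  \sum_(i in A) w i <= \sum_(j in B) w j.
Proof.
move=> eAB h; rewrite (big_setID B) [X in _ <= X](big_setID A) /= setIC leq_add2l.
have eD : #|A :\: B| = #|B :\: A|.
  by have := cardsID B A; have := cardsID A B; rewrite setIC eAB; lia.
pose th := \max_(i in A :\: B) w i.
apply: (@leq_trans (#|A :\: B| * th)).
  rewrite -sum_nat_const; apply: leq_sum => i iD.
  by rewrite /th (bigD1 i) //= leq_maxl.
rewrite eD -sum_nat_const; apply: leq_sum => j; rewrite inE => /andP[jA jB].
by apply/bigmax_leqP => i; rewrite inE => /andP[iB iA]; apply: h.
Qed.

Lemma sum_by_type n M (mask : nat -> nat) (J : {set 'I_n}) (f : nat -> nat) :
  (forall j : 'I_n, mask j < M) ->
  \sum_(j in J) f j = \sum_(t < M) \sum_(j in [set j in J | mask j == t]) f j.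
Proof.
move=> hM; under [RHS]eq_bigr => t _ do (rewrite big_mkcond /=).
rewrite exchange_big /= big_mkcond; apply: eq_bigr => j _.
rewrite (bigD1 (Ordinal (hM j))) //= inE eqxx andbT big1 ?addn0 // => t nt.
rewrite inE ifN // negb_and; apply/orP; right.
by apply: contraNN nt => /eqP e; apply/eqP/val_inj.
Qed.

(** Coverage depends only on the type counts, which [select] reproduces; and a set cheaper than a
    selected one of its type would have smaller rank, so it is selected too. *)
Lemma select_type_count n M (w mask : nat -> nat) (bit : nat -> nat -> bool) (J
  : {set 'I_n}) :
  (forall j : 'I_n, mask j < M) ->
  (forall (i j : 'I_n) k, mask i = mask j -> bit i k = bit j k) ->
  let C := select n w mask (type_count mask J) in
  (forall k, covered bit C k = covered bit J k) /\ total_weight w C <=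
    total_weight w J.
Proof.
move=> hM hbit C.
have eqc t : #|[set j in C | mask j == t]| = #|[set j in J | mask j == t]|.
  have := @type_count_select n w mask (type_count mask J) t.
  rewrite /type_count -!(sum_nat_set _ (fun j => mask j == t)); apply.
  by rewrite big_mkcond [X in _ <= X]big_mkcond; apply: leq_sum => j _;
    rewrite inE; case: ifP.
have con (K : {set 'I_n}) t k b0 :
    (forall j : 'I_n, mask j = t -> bit j k = b0) ->
    \sum_(j in [set j in K | mask j == t]) bit j k =
    #|[set j in K | mask j == t]| * b0.
  move=> hb; rewrite -sum_nat_const; apply: eq_bigr => j.
  by rewrite inE => /andP[_ /eqP /hb ->].
split=> [k|].
  rewrite /covered !(sum_by_type _ (fun j => bit j k) hM).
  apply: eq_bigr => t _.
  case: (pickP (fun j : 'I_n => mask j == t)) => [i /eqP mi|none]; last first.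
    by rewrite !big1 // => j; rewrite inE none andbF.
  by rewrite !(con _ _ _ (bit i k)) ?eqc // => j mj; apply: hbit; rewrite mi.
rewrite /total_weight !(sum_by_type _ w hM); apply: leq_sum => t _.
apply: leq_sum_exchange => // i j; rewrite !inE => /andP[ri /eqP mi].
move=> /andP[_ /eqP mj]; rewrite mj eqxx andbT -leqNgt => rj.
rewrite leqNgt; apply/negP => wji.
have := @rank_ltn n w mask j i; rewrite mi mj => /(_ erefl).
rewrite /before wji => /(_ isT); move: ri; rewrite mi => ri.
by move=> rji; have := leq_trans ri (leq_trans rj (ltnW rji)); rewrite ltnn.
Qed.

Lemma symdiffC (T : finType) (A B : {set T}) : symdiff A B = symdiff B A.
Proof. by apply/setP => j; rewrite !inE addbC. Qed.

Lemma type_count_symdiff n (mask : nat -> nat) (X Y : {set 'I_n}) t :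
  type_count mask X t <= type_count mask Y t + #|symdiff X Y|.
Proof.
rewrite -sum1_card /type_count big_mkcond [X in _ <= X + _]big_mkcond.
rewrite [X in _ <= _ + X]big_mkcond -big_split; apply: leq_sum => j _ /=.
by rewrite inE; case: (j \in X); case: (j \in Y); case: (mask j == t).
Qed.

(** The bound from [block_bound_leq], in a form that two rounds of doubling produce. *)
Definition window (m : nat) : nat := 2 ^ (2 ^ m.+2).

Definition capped (req : nat -> nat) (k i : nat) : nat := minn (req i) k.

(** Only the type counts of the nearby cover are kept. The interval is described from its lower end
    because decoding counts upwards from there; where the subtraction is truncated, the upper end
    only moves further up. *)
Lemma next_type_counts n m M (w mask req : nat -> nat)
    (bit : nat -> nat -> bool) k (X Y : {set 'I_n}) :
  (forall j : 'I_n, mask j < M) ->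
  (forall (i j : 'I_n) k, mask i = mask j -> bit i k = bit j k) ->
  covers m bit (capped req k) X ->
  (forall X' : {set 'I_n}, covers m bit (capped req k) X' ->
     total_weight w X <= total_weight w X') ->
  covers m bit (capped req k.+1) Y ->
  exists c : nat -> nat, [/\
    forall t, type_count mask X t - window m <= c t <=
      type_count mask X t - window m + (window m + window m),
    covers m bit (capped req k.+1) (select n w mask c) &
    total_weight w (select n w mask c) <= total_weight w Y].
Proof.
move=> hM hbit cX oX cY.
have [|Y' [cY' wY' dXY]] := cover_sensitivity _ cX oX cY.
  by move=> i _; rewrite /capped; lia.
have {}dXY : #|symdiff X Y'| <= window m.
  exact: leq_trans dXY (block_bound_leq m).
have [eC lC] := select_type_count w Y' hM hbit.
exists (type_count mask Y'); split.
- move=> t; have := type_count_symdiff mask X Y' t.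
  have := type_count_symdiff mask Y' X t; rewrite (symdiffC Y') => h1 h2; lia.
- by move=> i li; rewrite eC; apply: cY'.
- exact: leq_trans lC wY'.
Qed.

(** The proof rule for loops. Every iteration is also told that whatever the loop does not modify
    has its original value, so invariants need not carry frame conditions. *)
Lemma forP x v e c s (Inv : nat -> state -> Prop) :
  Inv 0 s ->
  (forall i s', i < evale x s e ->
     (forall u, u \notin v :: modv c -> sv s' u = sv s u) ->
     (forall a, a \notin moda c -> av s' a = av s a) ->
     Inv i s' -> Inv i.+1 (eval x c (setv s' v i))) ->
  Inv (evale x s e) (eval x (For v e c) s).
Proof.
move=> h0 hS /=; set f := fun i s' => _.
suff : forall k, k <= evale x s e -> [/\ Inv k (iteri k f s),
    forall u, u \notin v :: modv c -> sv (iteri k f s) u = sv s u &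
    forall a, a \notin moda c -> av (iteri k f s) a = av s a].
  by move=> /(_ _ (leqnn _))[].
elim=> [//|k IH] lk; have [hI hv ha] := IH (ltnW lk); split.
- exact: hS.
- move=> u hu; have := hu; rewrite inE negb_or => /andP[/negbTE nu nc].
  by rewrite /= /f eval_framev //= /upd nu hv.
- by move=> a hh; rewrite /= /f eval_framea ?ha.
Qed.

Lemma eval_seq x c1 c2 s : eval x (Seq c1 c2) s = eval x c2 (eval x c1 s).
Proof. by []. Qed.

(** * The program *)

Notation "c1 ;; c2" := (Seq c1 c2) (at level 90, right associativity).

Notation vOut := 0 (only parsing).
Notation vLen := 1 (only parsing).
Notation vPtr := 2 (only parsing).
Notation vM := 3 (only parsing).
Notation vN := 4 (only parsing).
Notation vN1 := 5 (only parsing).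
Notation vT := 6 (only parsing).
Notation vU := 7 (only parsing).
Notation vD := 8 (only parsing).
Notation vE := 9 (only parsing).
Notation vZ := 10 (only parsing).
Notation vVal := 11 (only parsing).
Notation vPw := 12 (only parsing).
Notation vGo := 13 (only parsing).
Notation vSgn := 14 (only parsing).
Notation vP := 15 (only parsing).
Notation vQ := 16 (only parsing).
Notation vI := 17 (only parsing).
Notation vJ := 18 (only parsing).
Notation vK := 19 (only parsing).
Notation vS := 20 (only parsing).
Notation vX := 21 (only parsing).
Notation vH := 22 (only parsing).
Notation vAcc := 23 (only parsing).
Notation vPt := 24 (only parsing).
Notation vCost := 25 (only parsing).
Notation vOk := 26 (only parsing).
Notation vFound := 27 (only parsing).
Notation vBest := 28 (only parsing).
Notation vSkip := 29 (only parsing).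

Notation aPos := 0 (only parsing).
Notation aMask := 1 (only parsing).
Notation aWt := 2 (only parsing).
Notation aRank := 3 (only parsing).
Notation aReq := 4 (only parsing).
Notation aCnt := 5 (only parsing).
Notation aCur := 6 (only parsing).
Notation aBest := 7 (only parsing).

(** * Parsing the encoded instance *)

Definition skip : cmd := Assign vSkip (EConst 0).

Definition incr (v : nat) (e : expr) : cmd := Assign v (EAdd (EVar v) e).

Definition read_nat : cmd :=
  Assign vVal (EConst 0);; Assign vPw (EConst 1);; Assign vGo (EConst 1);;
  For vI (EVar vLen)
    (If (EVar vGo)
       (If (EInp (EVar vPtr))
          (If (EInp (EAdd (EVar vPtr) (EConst 1))) (incr vVal (EVar vPw)) skip;;
           incr vPw (EVar vPw);; incr vPtr (EConst 2))
          (Assign vGo (EConst 0);; incr vPtr (EConst 1)))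
       skip).

Definition read_int : cmd :=
  Assign vSgn (EInp (EVar vPtr));; incr vPtr (EConst 1);; read_nat.

Lemma nth_pairs (bs r : seq bool) i : i < size bs ->
  let s := flatten [seq [:: true; b] | b <- bs] ++ r in
  nth false s (2 * i) = true /\ nth false s (2 * i).+1 = nth false bs i.
Proof.
elim: bs i => // b bs IH [|i] // li.
have -> : 2 * i.+1 = (2 * i).+2 by lia.
exact: IH.
Qed.

Lemma size_pairs (bs : seq bool) :
  size (flatten [seq [:: true; b] | b <- bs]) = 2 * size bs.
Proof. by elim: bs => //= b bs ->; rewrite mulnS. Qed.

Lemma modn_exp2S a i : a %% 2 ^ i.+1 = a %% 2 ^ i + odd (a %/ 2 ^ i) * 2 ^ i.
Proof.
have p0 : 0 < 2 ^ i by rewrite expn_gt0.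
rewrite {1}(divn_eq a (2 ^ i)) {1}(divn_eq (a %/ 2 ^ i) 2) modn2 mulnDl -mulnA.
rewrite -expnS -addnA modnMDl modn_small; first by rewrite addnC.
have := ltn_pmod a p0; rewrite expnS; case: odd; lia.
Qed.

Lemma read_natP x s a post :
  sv s vLen = size x -> drop (sv s vPtr) x = encode_nat a ++ post ->
  let s' := eval x read_nat s in
  sv s' vVal = a /\ drop (sv s' vPtr) x = post.
Proof.
move=> hlen hdrop; set p := sv s vPtr in hdrop.
rewrite /read_nat !eval_seq; set s0 := eval x (Assign vGo _) _.
pose L := size (binary a).
have bitE i : i < L -> nth false (binary a) i = odd (a %/ 2 ^ i).
  by rewrite /L /binary size_map size_iota => li; rewrite (nth_map 0) ?size_iota
    // nth_iota.
have aL : a %% 2 ^ L = a.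
  by rewrite modn_small // /L size_map size_iota; apply: up_logP.
have nx i : nth false x (p + i) =
    nth false (flatten [seq [:: true; b] | b <- binary a] ++ false :: post) i.
  by rewrite -nth_drop hdrop /encode_nat -catA.
have x1 i : i < L -> nth false x (p + 2 * i) /\
    nth false x (p + (2 * i).+1) = odd (a %/ 2 ^ i).
  by move=> li; have [h1 h2] := nth_pairs (false :: post) li; rewrite !nx h1 h2
    bitE.
have x0 : nth false x (p + 2 * L) = false.
  by rewrite nx nth_cat size_pairs ltnn subnn.
have sL : p + (2 * L).+1 <= size x.
  have := congr1 size hdrop; rewrite size_drop /encode_nat !size_cat size_pairs /=.
  by rewrite -/L; lia.
(* While i is at most L the low i bits have been read. Iteration L consumes the end marker, and the
   input is longer than L, so the second phase is always reached. *)
pose Inv i (s' : state) :=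
  if i <= L then [/\ sv s' vGo = 1, sv s' vVal = a %% 2 ^ i, sv s' vPw = 2 ^ i &
    sv s' vPtr = p + 2 * i]
  else [/\ sv s' vGo = 0, sv s' vVal = a & sv s' vPtr = p + (2 * L).+1].
have : Inv (size x) (eval x (For vI (EVar vLen)
    (If (EVar vGo)
       (If (EInp (EVar vPtr))
          (If (EInp (EAdd (EVar vPtr) (EConst 1))) (incr vVal (EVar vPw)) skip;;
           incr vPw (EVar vPw);; incr vPtr (EConst 2))
          (Assign vGo (EConst 0);; incr vPtr (EConst 1)))
       skip)) s0).
  have <- : evale x s0 (EVar vLen) = size x by [].
  apply: forP => [|i s' li _ _].
    by rewrite /Inv /= /upd /= modn1 muln0 addn0.
  rewrite /Inv; case: (leqP i L) => [iL [hg hv hp hptr]|iL [hg hv hptr]]; last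
    first.
    by rewrite ltnNge (ltnW iL) /= /upd /= hg.
  rewrite /= /upd /= hg /= hptr.
  case: (ltnP i L) => [ltiL|geiL]; last first.
    have -> : i = L by lia.
    rewrite x0 /= /upd /= hv (_ : i = L) ?aL; last by lia.
    by rewrite addn1 addnS.
  have [-> b1] := x1 i ltiL.
  rewrite /= addn1 -addnS b1 modn_exp2S.
  by case: odd => /=; rewrite /upd /= ?hg ?hv ?hp ?hptr; split=> //;
    rewrite ?mul1n ?mul0n ?addn0 ?expnS; lia.
rewrite /Inv leqNgt (_ : L < size x) /=; last by lia.
move=> [_ -> ->]; split=> //.
rewrite -[drop _ x]/(drop _ x) addnC -drop_drop hdrop /encode_nat -catA.
by rewrite drop_cat size_pairs -/L ltnNge leqnSn /= subSnn /= drop0.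
Qed.

Definition pos_part (z : int) : nat := if (z < 0)%R then 0 else absz z.
Definition neg_part (z : int) : nat := if (z < 0)%R then absz z else 0.

Lemma read_intP x s z post :
  sv s vLen = size x -> drop (sv s vPtr) x = encode_int z ++ post ->
  let s' := eval x read_int s in
  [/\ sv s' vSgn = (z < 0)%R, sv s' vVal = absz z & drop (sv s' vPtr) x = post].
Proof.
move=> hlen hdrop; rewrite /read_int !eval_seq.
set s1 := eval x (incr _ _) _.
have hS : sv s1 vSgn = (z < 0)%R.
  rewrite /s1 /= /upd /= -[sv s vPtr]addn0 -nth_drop hdrop //.
have hL : sv s1 vLen = size x by [].
have hP : drop (sv s1 vPtr) x = encode_nat (absz z) ++ post.
  by rewrite /s1 /= /upd /= addnC -drop_drop hdrop drop1.
have [hv hd] := read_natP hL hP.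
by split=> //; rewrite -hS; apply: eval_framev.
Qed.

(** Horner evaluation as done by [read_mask]. It is injective on strings of equal length, so masks
    can serve as names of types. *)
Fixpoint mask_value_rec (acc : nat) (bs : seq bool) : nat :=
  if bs is b :: bs' then mask_value_rec (acc + acc + b) bs' else acc.

Definition mask_value (bs : seq bool) : nat := mask_value_rec 0 bs.

Lemma mask_value_recE acc bs :
  mask_value_rec acc bs = acc * 2 ^ size bs + mask_value bs.
Proof.
rewrite /mask_value; elim: bs acc => [|b bs IH] acc /=; first by rewrite muln1
  addn0.
by rewrite IH [in RHS]IH expnS; lia.
Qed.

Lemma mask_value_rcons bs b :
  mask_value (rcons bs b) = mask_value bs + mask_value bs + b.
Proof.
rewrite /mask_value -cats1; move: 0; elim: bs => [|c bs IH] acc //=.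
Qed.

Lemma mask_value_ltn bs : mask_value bs < 2 ^ size bs.
Proof.
elim: bs => //= b bs IH; rewrite /mask_value /= mask_value_recE expnS.
by case: b => /=; lia.
Qed.

Lemma mask_value_inj bs bs' :
  size bs = size bs' -> mask_value bs = mask_value bs' -> bs = bs'.
Proof.
elim: bs bs' => [|b bs IH] [|b' bs'] //= [es].
rewrite /mask_value /= !mask_value_recE -es => e.
have := mask_value_ltn bs; have := mask_value_ltn bs'; rewrite -es => l1 l2.
have eb : b = b' by case: b b' e => [] [] //=; lia.
by rewrite eb (IH bs') //; move: e; rewrite eb; lia.
Qed.

Definition read_mask : cmd :=
  Assign vAcc (EConst 0);;
  For vI (EVar vM)
    (Assign vAcc (EAdd (EAdd (EVar vAcc) (EVar vAcc)) (EInp (EVar vPtr)));;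
     incr vPtr (EConst 1)).

Lemma read_maskP x s bs post :
  sv s vM = size bs -> drop (sv s vPtr) x = bs ++ post ->
  let s' := eval x read_mask s in
  sv s' vAcc = mask_value bs /\ sv s' vPtr = sv s vPtr + size bs.
Proof.
move=> hM hd; rewrite /read_mask eval_seq; set s0 := eval x (Assign _ _) s.
have eM : evale x s0 (EVar vM) = size bs by [].
pose Inv i s' := sv s' vAcc = mask_value (take i bs) /\
  sv s' vPtr = sv s vPtr + i.
suff : Inv (evale x s0 (EVar vM)) (eval x (For vI (EVar vM)
    (Assign vAcc (EAdd (EAdd (EVar vAcc) (EVar vAcc)) (EInp (EVar vPtr)));;
     incr vPtr (EConst 1))) s0).
  by rewrite eM /Inv take_size.
apply: forP => [|i s' li _ _ [h1 h2]]; first by rewrite /Inv take0 addn0.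
rewrite eM in li.
rewrite /Inv /= /upd /= h1 h2 (take_nth false) // mask_value_rcons addn1 addnS.
by rewrite -nth_drop hd nth_cat li.
Qed.

(** [aPos] records where the incidence bits lie, so that later membership tests reread the input
    instead of decoding a mask. A negative weight is stored as 0 and its absolute value credited to
    [vP]. *)
Definition parse_set : cmd :=
  AStore aPos (EVar vJ) (EVar vPtr);; read_mask;;
  AStore aMask (EVar vJ) (EVar vAcc);; read_int;;
  If (EVar vSgn)
    (incr vP (EVar vVal);; AStore aWt (EVar vJ) (EConst 0))
    (AStore aWt (EVar vJ) (EVar vVal)).

Definition parse_sets : cmd := For vJ (EVar vN) parse_set.

Lemma parse_setP x s bs z post :
  sv s vLen = size x -> sv s vM = size bs ->
  drop (sv s vPtr) x = bs ++ encode_int z ++ post ->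
  let j := sv s vJ in
  let s' := eval x parse_set s in
  [/\ drop (sv s' vPtr) x = post, sv s' vP = sv s vP + neg_part z,
      forall i, av s' aPos i = if i == j then sv s vPtr else av s aPos i,
      forall i, av s' aMask i = if i == j then mask_value bs else av s aMask i &
      forall i, av s' aWt i = if i == j then pos_part z else av s aWt i].
Proof.
move=> hL hM hd j; rewrite /parse_set.
rewrite eval_seq; set s1 := eval x (AStore _ _ _) s.
rewrite eval_seq; set s2 := eval x read_mask s1.
rewrite eval_seq; set s3 := eval x (AStore _ _ _) s2.
rewrite eval_seq; set s4 := eval x read_int s3.
have [a2 p2] := @read_maskP x s1 bs _ hM hd.
have f2 u : u \notin modv read_mask -> sv s2 u = sv s u.
  by move=> hu; rewrite /s2 eval_framev.
have hd3 : drop (sv s3 vPtr) x = encode_int z ++ post.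
  by rewrite /s3 /= [sv s2 vPtr]p2 addnC -drop_drop hd drop_size_cat.
have hL3 : sv s3 vLen = size x by rewrite /s3 /= f2.
have [g4 v4 d4] := read_intP hL3 hd3.
have j4 : sv s4 vJ = j by rewrite /s4 eval_framev //= f2.
have P4 : sv s4 vP = sv s vP by rewrite /s4 eval_framev //= f2.
have a4 a : av s4 a = av s3 a by apply: eval_framea.
have aE a i : av s4 a i = if a == aMask then (if i == j then mask_value bs else
  av s aMask i)
   else if a == aPos then (if i == j then sv s vPtr else av s aPos i) else av s a i.
  rewrite a4 /s3 /= f2 //; case: (eqVneq a aMask) => [_|na].
    by rewrite /upd a2; case: (eqVneq i j) => // _; rewrite /s2 eval_framea.
  rewrite /s2 eval_framea // /s1 /=; case: (eqVneq a aPos) => //.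
rewrite /= -/s4 g4 /pos_part /neg_part; case: (z < 0)%R => /=.
  rewrite /upd /= v4 P4 j4; split=> // i; first by rewrite aE.
  - by rewrite aE.
  - by case: eqP => // _; rewrite aE.
rewrite /upd /= v4 P4 j4 addn0; split=> // i; first by rewrite aE.
- by rewrite aE.
- by case: eqP => // _; rewrite aE.
Qed.

Lemma parse_setsP x s (l : seq (seq bool * int)) post :
  sv s vLen = size x -> sv s vN = size l ->
  (forall e, e \in l -> size e.1 = sv s vM) ->
  drop (sv s vPtr) x = flatten [seq e.1 ++ encode_int e.2 | e <- l] ++ post ->
  let s' := eval x parse_sets s in
  [/\ drop (sv s' vPtr) x = post,
      sv s' vP = sv s vP + \sum_(e <- l) neg_part e.2 &
      forall j, j < size l -> let e := nth ([::], 0%R) l j in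
        [/\ av s' aMask j = mask_value e.1, av s' aWt j = pos_part e.2 &
            forall i, i < sv s vM ->
              nth false x (av s' aPos j + i) = nth false e.1 i]].
Proof.
move=> hL hN hl hd.
pose d : seq bool * int := ([::], 0%R).
pose Inv j0 (s' : state) :=
  [/\ drop (sv s' vPtr) x =
        flatten [seq e.1 ++ encode_int e.2 | e <- drop j0 l] ++ post,
      sv s' vP = sv s vP + \sum_(e <- take j0 l) neg_part e.2 &
      forall j, j < j0 -> let e := nth d l j in
        [/\ av s' aMask j = mask_value e.1, av s' aWt j = pos_part e.2 &
            forall i, i < sv s vM ->
              nth false x (av s' aPos j + i) = nth false e.1 i]].
suff : Inv (evale x s (EVar vN)) (eval x parse_sets s).
  by rewrite [evale _ _ _]/= hN /Inv drop_size take_size.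
apply: forP => [|j s' lj fv fa [h1 h2 h3]].
  by rewrite /Inv drop0 take0 big_nil addn0.
rewrite /= hN in lj.
set e := nth d l j.
have el : e \in l by apply: mem_nth.
have dE : drop j l = e :: drop j.+1 l by rewrite (drop_nth d).
set s1 := setv s' vJ j.
have hd1 : drop (sv s1 vPtr) x = e.1 ++ encode_int e.2 ++
    (flatten [seq e.1 ++ encode_int e.2 | e <- drop j.+1 l] ++ post).
  by rewrite [LHS]h1 dE [RHS]catA [RHS]catA.
have hL1 : sv s1 vLen = size x by rewrite /s1 /= /upd /= fv ?hL.
have hM1 : sv s1 vM = size e.1 by rewrite /s1 /= /upd /= fv // (hl _ el).
have [r1 r2 r3 r4 r5] := parse_setP hL1 hM1 hd1.
split=> //.
  by rewrite r2 /= /upd /= h2 (take_nth d) // -cats1 big_cat big_seq1 addnA.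
move=> i; rewrite ltnS leq_eqVlt => /orP[/eqP ->|li].
  rewrite -/e r3 r4 r5 eqxx; split=> // i' li'.
  by rewrite -nth_drop [drop _ x]hd1 nth_cat (hl e el) li'.
have nij : (i == sv s1 vJ) = false by rewrite /s1 /= /upd /=; lia.
by rewrite r3 r4 r5 nij; apply: h3.
Qed.

Definition parse_requirements : cmd :=
  For vJ (EVar vM)
    (read_int;;
     If (EVar vSgn) (AStore aReq (EVar vJ) (EConst 0))
       (AStore aReq (EVar vJ) (EVar vVal))).

Lemma parse_requirementsP x s (l : seq int) post :
  sv s vLen = size x -> sv s vM = size l ->
  drop (sv s vPtr) x = flatten [seq encode_int z | z <- l] ++ post ->
  let s' := eval x parse_requirements s in
  drop (sv s' vPtr) x = post /\
  forall j, j < size l -> av s' aReq j = pos_part (nth 0%R l j).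
Proof.
move=> hL hM hd.
pose Inv j0 (s' : state) :=
  drop (sv s' vPtr) x = flatten [seq encode_int z | z <- drop j0 l] ++ post /\
  forall j, j < j0 -> av s' aReq j = pos_part (nth 0%R l j).
suff : Inv (evale x s (EVar vM)) (eval x parse_requirements s).
  by rewrite [evale _ _ _]/= hM /Inv drop_size.
apply: forP => [|j s' lj fv fa [h1 h2]].
  by rewrite /Inv drop0.
rewrite /= hM in lj.
rewrite eval_seq; set s1 := setv s' vJ j; set s2 := eval x read_int s1.
have hd1 : drop (sv s1 vPtr) x = encode_int (nth 0%R l j) ++
    (flatten [seq encode_int z | z <- drop j.+1 l] ++ post).
  by rewrite [LHS]h1 (drop_nth 0%R lj) [RHS]catA.
have hL1 : sv s1 vLen = size x by rewrite /s1 /= /upd /= fv ?hL.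
have [r1 r2 r3] := read_intP hL1 hd1.
have j2 : sv s2 vJ = j by rewrite /s2 eval_framev.
have a2 : av s2 aReq = av s' aReq by rewrite /s2 eval_framea.
rewrite /Inv /= -/s2 r1 /pos_part.
case: (boolP (nth 0%R l j < 0)%R) => hz /=; rewrite /upd /= j2 a2; split=> // i li;
  case: (eqVneq i j) => [->|nij].
- by rewrite hz.
- by apply: h2; lia.
- by rewrite (negbTE hz).
- by apply: h2; lia.
Qed.

(** Registers are natural numbers, so the budget inequality is kept two-sided: cost plus [vQ]
    against [vP]. *)
Definition parse_budget : cmd :=
  read_int;;
  If (EVar vSgn) (Assign vQ (EVar vVal)) (incr vP (EVar vVal)).

Lemma parse_budgetP x s z :
  sv s vLen = size x -> drop (sv s vPtr) x = encode_int z -> sv s vQ = 0 ->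
  let s' := eval x parse_budget s in
  sv s' vQ = neg_part z /\ sv s' vP = sv s vP + pos_part z.
Proof.
move=> hL hd hQ; rewrite -[encode_int z]cats0 in hd.
have [r1 r2 r3] := read_intP hL hd.
rewrite /parse_budget eval_seq; set s1 := eval x read_int s.
have Q1 : sv s1 vQ = 0 by rewrite /s1 eval_framev.
have P1 : sv s1 vP = sv s vP by apply: eval_framev.
rewrite /= -/s1 r1 /pos_part /neg_part.
by case: (z < 0)%R => /=; rewrite /upd /= r2 P1 ?Q1 ?addn0.
Qed.

(** * Bounds that depend only on the size of the universe *)

Definition code_length (m : nat) : nat := 2 ^ m * (window m + window m).+1.

Definition double_loop (v u : nat) : cmd := For vI (EVar u) (incr v (EVar v)).

Lemma double_loopP x s v u : v != vI ->
  sv (eval x (double_loop v u) s) v = sv s v * 2 ^ sv s u.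
Proof.
move=> nv; apply: (@forP x vI (EVar u) (incr v (EVar v)) s
  (fun i s' => sv s' v = sv s v * 2 ^ i)) => [|i s' _ _ _ h].
  by rewrite muln1.
by rewrite /= /upd eqxx (negbTE nv) h expnS; lia.
Qed.

(** With D the window, each of the 2^m types contributes 2D + 1 to [vE]: a code needs at most 2D
    increments for it and one move to the next type. [vZ] is the number of codes of that length. *)
Definition compute_bounds : cmd :=
  Assign vT (EConst 1);; double_loop vT vM;;
  Assign vU (EAdd (EAdd (EVar vT) (EVar vT)) (EAdd (EVar vT) (EVar vT)));;
  Assign vD (EConst 1);; double_loop vD vU;;
  Assign vE (EConst 0);;
  For vI (EVar vT) (incr vE (EAdd (EAdd (EVar vD) (EVar vD)) (EConst 1)));;
  Assign vZ (EConst 1);; double_loop vZ vE.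

Lemma compute_boundsP x s : let s' := eval x compute_bounds s in
  let m := sv s vM in
  [/\ sv s' vT = 2 ^ m, sv s' vD = window m, sv s' vE = code_length m &
      sv s' vZ = 2 ^ code_length m].
Proof.
rewrite /compute_bounds.
rewrite eval_seq; set s1 := eval x (Assign _ _) s.
rewrite eval_seq; set s2 := eval x (double_loop _ _) s1.
rewrite eval_seq; set s3 := eval x (Assign _ _) s2.
rewrite eval_seq; set s4 := eval x (Assign _ _) s3.
rewrite eval_seq; set s5 := eval x (double_loop _ _) s4.
rewrite eval_seq; set s6 := eval x (Assign _ _) s5.
rewrite eval_seq; set s7 := eval x (For _ _ _) s6.
rewrite eval_seq; set s8 := eval x (Assign _ _) s7.
set s9 := eval x (double_loop _ _) s8; move=> /=.
have T2 : sv s2 vT = 2 ^ sv s vM by rewrite /s2 double_loopP //= /upd /= mul1n.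
have D5 : sv s5 vD = window (sv s vM).
  rewrite /s5 double_loopP //= /upd /= mul1n [sv s2 _]T2 /window !expnS; congr
    (_ ^ _).
  by lia.
have T5 : sv s5 vT = 2 ^ sv s vM by rewrite /s5 eval_framev.
have E7 : sv s7 vE = code_length (sv s vM).
  have : sv s7 vE = sv s6 vT * (sv s6 vD + sv s6 vD).+1.
    apply: (@forP x vI (EVar vT) _ s6 (fun i s' =>
      sv s' vE = i * (sv s6 vD + sv s6 vD).+1)) => [//|i s' _ fv _ h].
    by rewrite /= /upd /= h !(fv vD) //= /upd /=; lia.
  by rewrite /s6 /= /upd /= T5 D5.
have E9 : sv s9 vE = code_length (sv s vM) by rewrite /s9 eval_framev.
have T9 : sv s9 vT = 2 ^ sv s vM.
  by rewrite /s9 eval_framev //= /upd /= /s7 eval_framev.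
have D9 : sv s9 vD = window (sv s vM).
  by rewrite /s9 eval_framev //= /upd /= /s7 eval_framev.
by split=> //; rewrite /s9 double_loopP //= /upd /= mul1n E7.
Qed.

(** Comparisons use truncated subtraction: two numbers are equal when the sum of both differences is
    0. *)
Definition compute_ranks : cmd :=
  For vJ (EVar vN)
    (Assign vAcc (EConst 0);;
     For vI (EVar vN)
       (If (EAdd (ESub (EArr aMask (EVar vI)) (EArr aMask (EVar vJ)))
                 (ESub (EArr aMask (EVar vJ)) (EArr aMask (EVar vI))))
          skip
          (If (ESub (EArr aWt (EVar vJ)) (EArr aWt (EVar vI)))
             (incr vAcc (EConst 1))
             (If (ESub (EArr aWt (EVar vI)) (EArr aWt (EVar vJ)))
                skip
                (If (ESub (EVar vJ) (EVar vI)) (incr vAcc (EConst 1)) skip))));;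
     AStore aRank (EVar vJ) (EVar vAcc)).

Lemma compute_ranksP x s j : j < sv s vN ->
  av (eval x compute_ranks s) aRank j =
  rank (sv s vN) (av s aWt) (av s aMask) j.
Proof.
move: j; set w := av s aWt; set mask := av s aMask; set n := sv s vN.
apply: (@forP x vJ (EVar vN) _ s (fun j0 s' => forall j, j < j0 ->
  av s' aRank j = rank n w mask j)) => [//|j s' lj fv fa h].
rewrite !eval_seq; set s1 := eval x (Assign _ _) _; set s2 := eval x (For _ _ _) s1.
have ew : av s1 aWt = w by rewrite /= fa.
have em : av s1 aMask = mask by rewrite /= fa.
have en : evale x s1 (EVar vN) = n by rewrite /= /upd /= fv.
have ej : sv s1 vJ = j by [].
have hA : sv s2 vAcc = rank n w mask j.
  rewrite /rank -(big_mkord xpredT (fun i => nat_of_bool ((mask i == mask j) &&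
    before w i j))).
  rewrite -en.
  apply: (@forP x vI (EVar vN) _ s1 (fun i s' => sv s' vAcc =
    \sum_(0 <= i' < i) ((mask i' == mask j) && before w i' j))) => [|i s'' li
      fv' fa' hi].
    by rewrite big_geq.
  rewrite big_nat_recr //= -hi /= /upd /= !fa' // ew em !(fv' vJ) // ej /before.
  case: (eqVneq (mask i) (mask j)) => [->|nm] /=; last first.
    by rewrite ifT /= ?addn0 //; lia.
  rewrite subnn /=; case: (ltngtP (w i) (w j)) => hw /=.
  - by rewrite ifT //=; lia.
  - rewrite ifN /=; last by lia.
    by rewrite ifT /= ?addn0 //; lia.
  - rewrite hw subnn /=; case: (ltnP i j) => hij; first by rewrite ifT //=; lia.
    by rewrite ifN /= ?addn0 //; lia.
have j2 : sv s2 vJ = j by rewrite /s2 eval_framev.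
have a2 : av s2 aRank = av s' aRank by rewrite /s2 eval_framea.
move=> i li; rewrite /= /upd j2 a2 hA; case: (eqVneq i j) => [-> //|nij].
by apply: h; lia.
Qed.

(** * Vectors of type counts as bit strings *)

Definition decode_step (d : nat * (nat -> nat) * nat) : nat * (nat -> nat) * nat :=
  let: (pt, cnt, b) := d in
  (if odd b then (pt, upd cnt pt (cnt pt).+1) else (pt.+1, cnt), b./2).

(** The code lists, for each type in turn, c t - cnt t ones followed by a zero, least significant
    bit first. That the counts before [pt] stay fixed is what lets the induction move on to the next
    type. *)
Lemma decode_onto (c : nat -> nat) E T pt (cnt : nat -> nat) :
  (forall t, pt <= t < pt + T -> cnt t <= c t) ->
  \sum_(pt <= t < pt + T) (c t - cnt t).+1 <= E ->
  exists2 b, b < 2 ^ E &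
    forall t,
      (pt <= t < pt + T -> (iter E decode_step (pt, cnt, b)).1.2 t = c t) /\
      (t < pt -> (iter E decode_step (pt, cnt, b)).1.2 t = cnt t).
Proof.
(* Short codes are padded: trailing zeros move the pointer but change no count. *)
have zero k p (g : nat -> nat) : (iter k decode_step (p, g, 0)).1.2 = g.
  suff [p' ->] : exists p', iter k decode_step (p, g, 0) = (p', g, 0) by [].
  by elim: k => [|k [p' /= ->]]; [exists p | exists p'.+1].
elim: E T pt cnt => [|E IH] [|T] pt cnt hle hE.
- by exists 0 => // t; rewrite zero addn0; split=> [ht|//]; lia.
- by move: hE; rewrite big_ltn //; lia.
- by exists 0; rewrite ?expn_gt0 // => t; rewrite zero addn0; split=> [ht|//]; lia.
move: hE; rewrite big_ltn; last by lia.
rewrite addnS => hE.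
case: (ltnP (cnt pt) (c pt)) => hc.
  have [||b lb hb] := IH T.+1 pt (upd cnt pt (cnt pt).+1).
  - by move=> t ht; rewrite /upd; case: eqP => [->//|_]; apply: hle.
  - rewrite addnS big_ltn; last by lia.
    rewrite {1}/upd eqxx (eq_big_nat _ _ (F2 := fun t => (c t - cnt t).+1));
      first by lia.
    by move=> t ht; rewrite /upd ifN //; lia.
  exists (b.*2.+1); first by rewrite expnS; lia.
  have stepE : decode_step (pt, cnt, b.*2.+1) = (pt, upd cnt pt (cnt pt).+1, b).
    by rewrite /decode_step /= odd_double uphalf_double.
  move=> t; rewrite iterSr stepE.
  have [h1 h2] := hb t; split=> ht; first by apply: h1; lia.
  by rewrite [LHS](h2 ht) /upd ifN //; lia.
have ec : cnt pt = c pt by apply/eqP; rewrite eqn_leq hc hle //; lia.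
have [||b lb hb] := IH T pt.+1 cnt.
- by move=> t ht; apply: hle; lia.
- by rewrite [pt.+1 + T]addSn; lia.
exists (b.*2); first by rewrite expnS; lia.
have stepE : decode_step (pt, cnt, b.*2) = (pt.+1, cnt, b).
  by rewrite /decode_step odd_double doubleK.
move=> t; rewrite iterSr stepE.
have [h1 h2] := hb t; split=> [ht|ht]; last by apply: h2; lia.
case: (eqVneq t pt) => [->|nt]; first by rewrite (proj2 (hb pt)).
by apply: h1; lia.
Qed.

(* The bits of the candidate [vS] are instructions: 1 increments the count of
   the current type and 0 moves on to the next type.  Counts start [vD] below
   their current values. *)
Definition decode : cmd :=
  For vI (EVar vT)
    (AStore aCnt (EVar vI) (ESub (EArr aCur (EVar vI)) (EVar vD)));;
  Assign vPt (EConst 0);; Assign vX (EVar vS);;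
  For vI (EVar vE)
    (Assign vH (EHalf (EVar vX));;
     If (ESub (ESub (EVar vX) (EVar vH)) (EVar vH))
       (AStore aCnt (EVar vPt) (EAdd (EArr aCnt (EVar vPt)) (EConst 1)))
       (incr vPt (EConst 1));;
     Assign vX (EVar vH)).

(** The starting counts are existential because array entries beyond the types hold leftovers of
    earlier candidates. *)
Lemma decodeP x s : exists cnt : nat -> nat,
  (forall t, t < sv s vT -> cnt t = av s aCur t - sv s vD) /\
  av (eval x decode s) aCnt =
    (iter (sv s vE) decode_step (0, cnt, sv s vS)).1.2.
Proof.
rewrite /decode eval_seq; set s1 := eval x (For _ _ _) s.
rewrite eval_seq; set s2 := eval x (Assign _ _) s1.
rewrite eval_seq; set s3 := eval x (Assign _ _) s2.
have h1 : forall t, t < sv s vT -> av s1 aCnt t = av s aCur t - sv s vD.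
  apply: (@forP x vI (EVar vT) _ s (fun i s' => forall t, t < i ->
    av s' aCnt t = av s aCur t - sv s vD)) => [//|i s' li fv fa h].
  move=> t lt; rewrite /= /upd /= fa // fv //.
  by case: (eqVneq t i) => [-> //|nt]; apply: h; lia.
exists (av s1 aCnt); split=> //.
have fs v : v != vI -> sv s1 v = sv s v.
  by move=> hv; rewrite /s1 eval_framev //= inE.
have eE : evale x s3 (EVar vE) = sv s vE by rewrite /= /upd /= fs.
rewrite -eE; set it := fun k => iter k decode_step (0, av s1 aCnt, sv s vS).
suff : (fun i s' => (sv s' vPt, av s' aCnt, sv s' vX) = it i)
    (evale x s3 (EVar vE)) (eval x (For vI (EVar vE)
    (Assign vH (EHalf (EVar vX));;
     If (ESub (ESub (EVar vX) (EVar vH)) (EVar vH))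
       (AStore aCnt (EVar vPt) (EAdd (EArr aCnt (EVar vPt)) (EConst 1)))
       (incr vPt (EConst 1));;
     Assign vX (EVar vH))) s3).
  by rewrite /it => <-.
apply: (@forP x vI (EVar vE) _ s3 (fun i s' =>
  (sv s' vPt, av s' aCnt, sv s' vX) = it i)) => [|i s' li fv fa h].
  by rewrite /it /= /upd /= fs.
rewrite /it /= -/(it i) -h /= /upd /=.
have -> : sv s' vX - (sv s' vX)./2 - (sv s' vX)./2 = odd (sv s' vX).
  by rewrite -{1}(odd_double_half (sv s' vX)); lia.
by case: odd => //=; rewrite /upd /= addn1.
Qed.

(** * One stage: testing all candidates *)

Record ready (x : seq bool) (n m : nat) (w mask req : nat -> nat)
    (bit : nat -> nat -> bool) (s : state) : Prop := Ready {
  ready_m : sv s vM = m;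
  ready_n : sv s vN = n;
  ready_t : sv s vT = 2 ^ m;
  ready_d : sv s vD = window m;
  ready_e : sv s vE = code_length m;
  ready_z : sv s vZ = 2 ^ code_length m;
  ready_mask : forall j, j < n -> av s aMask j = mask j;
  ready_wt : forall j, j < n -> av s aWt j = w j;
  ready_rank : forall j, j < n -> av s aRank j = rank n w mask j;
  ready_req : forall i, i < m -> av s aReq i = req i;
  ready_bit : forall j i, j < n -> i < m ->
    nth false x (av s aPos j + i) = bit j i
}.

Definition ready_vars : seq nat := [:: vM; vN; vT; vD; vE; vZ].
Definition ready_arrays : seq nat := [:: aPos; aMask; aWt; aRank; aReq].

Lemma ready_frame x n m w mask req bit s s' :
  ready x n m w mask req bit s ->
  {in ready_vars, sv s' =1 sv s} -> {in ready_arrays, av s' =1 av s} ->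
  ready x n m w mask req bit s'.
Proof.
case=> h1 h2 h3 h4 h5 h6 h7 h8 h9 h10 h11 hv ha.
by split; rewrite ?hv ?ha // => i j; rewrite ha //; apply: h11.
Qed.

(** The parsed data are never written again; for a concrete command this is settled by computation
    on its syntax. *)
Lemma ready_eval x n m w mask req bit c s :
  all (fun v => v \notin modv c) ready_vars ->
  all (fun a => a \notin moda c) ready_arrays ->
  ready x n m w mask req bit s -> ready x n m w mask req bit (eval x c s).
Proof.
move=> /allP hv /allP ha hr; apply: ready_frame hr _ _ => [v /hv|a /ha] h.
  exact: eval_framev.
exact: eval_framea.
Qed.

Lemma ready_setv x n m w mask req bit s v k : v \notin ready_vars ->
  ready x n m w mask req bit s -> ready x n m w mask req bit (setv s v k).
Proof.
move=> nv hr; apply: ready_frame hr _ _ => // u hu /=.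
by rewrite /upd ifN //; apply: contraNneq nv => <-.
Qed.

Definition selected (a : nat) : expr :=
  ESub (EArr a (EArr aMask (EVar vJ))) (EArr aRank (EVar vJ)).

Definition sum_selected (v : nat) (e : expr) : cmd :=
  Assign v (EConst 0);;
  For vJ (EVar vN) (If (selected aCnt) (incr v e) skip).

Lemma sum_selectedP x n m w mask req bit s v e (F : nat -> nat) :
  ready x n m w mask req bit s -> v \notin [:: vJ; vN; vSkip] ->
  (forall s' j, j < n -> (forall u, u \notin [:: vJ; v; vSkip] -> sv s' u = sv s
    u) ->
     av s' = av s -> sv s' vJ = j -> evale x s' e = F j) ->
  sv (eval x (sum_selected v e) s) v =
  \sum_(j in select n w mask (av s aCnt)) F j.
Proof.
rewrite !inE !negb_or => hr /and3P[vj vn vs] he.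
rewrite /sum_selected eval_seq; set s1 := eval x (Assign _ _) s.
set sel := fun j => rank n w mask j < av s aCnt (mask j).
have -> : \sum_(j in select n w mask (av s aCnt)) F j =
    \sum_(0 <= j < n) (if sel j then F j else 0).
  by rewrite big_mkord big_mkcond; apply: eq_bigr => j _; rewrite inE.
have en : evale x s1 (EVar vN) = n.
  by rewrite /= /upd eq_sym (negbTE vn) (ready_n hr).
rewrite -[in RHS]en.
suff : (fun j s' => av s' = av s /\ sv s' v = \sum_(0 <= i < j) (if sel i then F
  i else 0))
  (evale x s1 (EVar vN))
  (eval x (For vJ (EVar vN) (If (selected aCnt) (incr v e) skip)) s1) by case.
apply: (@forP x vJ (EVar vN) _ s1 (fun j s' => av s' = av s /\ sv s' v =
  \sum_(0 <= i < j) (if sel i then F i else 0))) => [|j s' lj fv fa [ha hs]].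
  by rewrite big_geq //= /upd eqxx.
rewrite en in lj; rewrite big_nat_recr //= ha /upd /=.
rewrite (ready_mask hr lj) (ready_rank hr lj).
have -> : (av s aCnt (mask j) - rank n w mask j != 0) = sel j by rewrite /sel; lia.
case: (sel j) => /=; rewrite ha; split=> //; rewrite /upd.
  rewrite eqxx (negbTE vj) hs; congr (_ + _); apply: he => //= u hu.
  rewrite !inE !negb_or in hu; case/and3P: hu => u1 u2 u3.
  rewrite /upd (negbTE u1) fv; last by rewrite !inE !negb_or u1 u2 u3.
  by rewrite /= /upd (negbTE u2).
by rewrite (negbTE vs) (negbTE vj) hs addn0.
Qed.

(* In stage [vK] the requirements are capped at [vK] + 1. *)
Definition check_cover : cmd :=
  Assign vOk (EConst 1);;
  For vI (EVar vM)
    (sum_selected vAcc (EInp (EAdd (EArr aPos (EVar vJ)) (EVar vI)));;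
     If (ESub (EArr aReq (EVar vI)) (EVar vAcc))
       (If (ESub (EAdd (EVar vK) (EConst 1)) (EVar vAcc))
          (Assign vOk (EConst 0)) skip)
       skip).

Lemma check_coverP x n m w mask req bit s :
  ready x n m w mask req bit s ->
  sv (eval x check_cover s) vOk != 0 <->
  covers m bit (capped req (sv s vK).+1) (select n w mask (av s aCnt)).
Proof.
move=> hr; rewrite /check_cover eval_seq; set s0 := eval x (Assign _ _) s.
set C := select n w mask (av s aCnt).
have em : evale x s0 (EVar vM) = m by rewrite /= /upd /= (ready_m hr).
rewrite -[in X in _ <-> X]em.
apply: (@forP x vI (EVar vM) _ s0 (fun i s' => sv s' vOk != 0 <->
  covers i bit (capped req (sv s vK).+1) C)) => [|i s' li fv fa h].
  by split=> // _ k.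
rewrite em in li.
set s1 := setv s' vI i; rewrite eval_seq; set s2 := eval x (sum_selected _ _) s1.
have hr1 : ready x n m w mask req bit s1.
  apply: ready_setv => //; apply: ready_frame hr _ _ => [u|a].
    rewrite !inE => hu; rewrite fv; last by move: hu; do 5?case/orP; move/eqP->.
    by rewrite /= /upd ifN //; move: hu; do 5?case/orP; move/eqP->.
  by rewrite !inE => ha; rewrite fa //; move: ha; do 4?case/orP; move/eqP->.
have c1 : av s1 aCnt = av s aCnt by rewrite /= fa.
have hacc : sv s2 vAcc = covered bit C i.
  rewrite /s2 (sum_selectedP (F := fun j => bit j i) hr1) //; first by rewrite c1.
  move=> s'' j lj fu ea ej /=; rewrite ej fu //= ea; congr nat_of_bool.
  exact: (ready_bit hr1).
have i2 : sv s2 vI = i by rewrite /s2 eval_framev.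
have k2 : sv s2 vK = sv s vK by rewrite /s2 eval_framev //= /upd /= fv.
have o2 : sv s2 vOk = sv s' vOk by rewrite /s2 eval_framev.
have r2 : av s2 aReq i = req i by rewrite /s2 eval_framea // (ready_req hr1).
rewrite /= -/s2 i2 r2 hacc k2 addn1.
(* A coverage is too small for the minimum of two numbers exactly when it is too small for both,
   hence the nested tests. *)
have eq1 : sv (if req i - covered bit C i != 0
   then if (sv s vK).+1 - covered bit C i != 0 then setv s2 vOk 0 else setv s2
     vSkip 0
   else setv s2 vSkip 0) vOk =
   if capped req (sv s vK).+1 i <= covered bit C i then sv s2 vOk else 0.
  rewrite /capped geq_min -!subn_eq0.
  by case: eqP => //= _; case: eqP.
rewrite eq1 o2; split.
  case: ifP => // hi /h hc k; rewrite ltnS leq_eqVlt => /orP[/eqP -> //|];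
    exact: hc.
move=> hc; rewrite hc //; apply/h => k lk; apply: hc; exact: ltnW.
Qed.

(** The sum in the inner test is nonzero if nothing has been found yet or the new cost is strictly
    smaller than the best one. *)
Definition candidate : cmd :=
  decode;; sum_selected vCost (EArr aWt (EVar vJ));; check_cover;;
  If (EVar vOk)
    (If (EAdd (ESub (EConst 1) (EVar vFound)) (ESub (EVar vBest) (EVar vCost)))
       (Assign vBest (EVar vCost);; Assign vFound (EConst 1);;
        For vI (EVar vT) (AStore aBest (EVar vI) (EArr aCnt (EVar vI))))
       skip)
    skip.

Definition search : cmd := Assign vFound (EConst 0);; For vS (EVar vZ) candidate.

Lemma eq_select n (w mask c c' : nat -> nat) :
  (forall j : 'I_n, c (mask j) = c' (mask j)) ->
  select n w mask c = select n w mask c'.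
Proof. by move=> h; apply/setP => j; rewrite !inE h. Qed.

Lemma candidateP x n m w mask req bit s :
  (forall j, j < n -> mask j < 2 ^ m) ->
  ready x n m w mask req bit s ->
  let s' := eval x candidate s in
  let cnt := av (eval x decode s) aCnt in
  let C := select n w mask cnt in
  (covers m bit (capped req (sv s vK).+1) C /\
     (sv s vFound = 0 \/ total_weight w C < sv s vBest) /\
     sv s' vFound = 1 /\ sv s' vBest = total_weight w C /\
     select n w mask (av s' aBest) = C) \/
  (~ (covers m bit (capped req (sv s vK).+1) C /\
     (sv s vFound = 0 \/ total_weight w C < sv s vBest)) /\
     sv s' vFound = sv s vFound /\ sv s' vBest = sv s vBest /\
     av s' aBest = av s aBest).
Proof.
move=> hmask hr; rewrite /candidate eval_seq; set s1 := eval x decode s.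
rewrite eval_seq; set s2 := eval x (sum_selected _ _) s1.
rewrite eval_seq; set s3 := eval x check_cover s2.
set cnt := av s1 aCnt; set C := select n w mask cnt; set s' := eval x _ s3.
have hr1 : ready x n m w mask req bit s1 by apply: ready_eval.
have hr2 : ready x n m w mask req bit s2 by apply: ready_eval.
have hr3 : ready x n m w mask req bit s3 by apply: ready_eval.
have cnt2 : av s2 aCnt = cnt by rewrite /s2 eval_framea.
have cnt3 : av s3 aCnt = cnt by rewrite /s3 eval_framea.
have k2 : sv s2 vK = sv s vK by rewrite /s2 eval_framev // /s1 eval_framev.
have hcost : sv s2 vCost = total_weight w C.
  rewrite /s2 (sum_selectedP (F := w) hr1) // => s'' j lj _ ea ej /=.
  by rewrite ej ea (ready_wt hr1).
have hcost3 : sv s3 vCost = total_weight w C by rewrite /s3 eval_framev.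
have hok := check_coverP hr2; rewrite cnt2 k2 -/C -/s3 in hok.
have f3 : sv s3 vFound = sv s vFound.
  by rewrite /s3 eval_framev // /s2 eval_framev // /s1 eval_framev.
have b3 : sv s3 vBest = sv s vBest.
  by rewrite /s3 eval_framev // /s2 eval_framev // /s1 eval_framev.
have a3 : av s3 aBest = av s aBest.
  by rewrite /s3 eval_framea // /s2 eval_framea // /s1 eval_framea.
rewrite /s'; set upd_best := (Assign vBest _;; _).
have -> : eval x (If (EVar vOk) (If (EAdd (ESub (EConst 1) (EVar vFound))
    (ESub (EVar vBest) (EVar vCost))) upd_best skip) skip) s3 =
  if sv s3 vOk != 0 then
    if (1 - sv s vFound) + (sv s vBest - total_weight w C) != 0
    then eval x upd_best s3 else setv s3 vSkip 0
  else setv s3 vSkip 0.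
  by rewrite -f3 -b3 -hcost3.
case: (boolP (sv s3 vOk != 0)) => ok; last first.
  right; split; first by move=> [/hok]; rewrite (negbTE ok).
  by rewrite /= /upd /= f3 b3.
case: ifP => he.
  left; split; first exact/hok.
  split; first by lia.
  rewrite /upd_best !eval_seq; set s4 := eval x (Assign vFound _) _.
  split; first by rewrite eval_framev.
  split; first by rewrite eval_framev //= /upd /= hcost3.
  apply: eq_select => j; have := hmask j (ltn_ord j).
  rewrite -(ready_t hr3); move: (mask j) => t.
  have -> : sv s3 vT = evale x s4 (EVar vT) by [].
  move: t; apply: (@forP x vI (EVar vT) _ s4 (fun i s' => forall t, t < i ->
    av s' aBest t = cnt t)) => [//|i s'' li fv fa h] t lt.
  rewrite /= /upd /= fa //= cnt3.
  by case: (eqVneq t i) => [-> //|nt]; apply: h; lia.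
right; split; first by move=> [_]; lia.
by rewrite /= /upd /= f3 b3.
Qed.

(** Instructions act on one entry at a time, so leftovers beyond the types cannot influence the
    counts that matter. *)
Lemma decode_agree T k pt b (f g : nat -> nat) :
  (forall t, t < T -> f t = g t) ->
  forall t, t < T -> (iter k decode_step (pt, f, b)).1.2 t =
    (iter k decode_step (pt, g, b)).1.2 t.
Proof.
elim: k pt b f g => [//|k IH] pt b f g h t lt; rewrite !iterSr /=.
case: odd; last exact: IH.
apply: IH => // u lu; rewrite /upd; case: eqP => [e|_]; last exact: h.
by rewrite h // -e.
Qed.

(** The recorded best is always a genuine cover, and it is no worse than any count vector in the
    window, because [decode_onto] supplies a code for that vector and all codes are tried. *)
Lemma searchP x n m w mask req bit s :
  (forall j, j < n -> mask j < 2 ^ m) ->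
  ready x n m w mask req bit s ->
  let s' := eval x search s in
  let C := select n w mask (av s' aBest) in
  (sv s' vFound != 0 -> covers m bit (capped req (sv s vK).+1) C /\
     sv s' vBest = total_weight w C) /\
  (forall c : nat -> nat,
     (forall t, t < 2 ^ m -> av s aCur t - window m <= c t <=
        av s aCur t - window m + (window m + window m)) ->
     covers m bit (capped req (sv s vK).+1) (select n w mask c) ->
     sv s' vFound != 0 /\ sv s' vBest <= total_weight w (select n w mask c)).
Proof.
move=> hmask hr; rewrite /search eval_seq; set s0 := eval x (Assign _ _) s.
set s' := eval x _ s0; cbv zeta.
set k := sv s vK; set cnt0 := fun t => av s aCur t - window m.
set C := fun b => select n w mask (iter (code_length m) decode_step (0, cnt0,
  b)).1.2.
have selE f b : (forall t, t < 2 ^ m -> f t = cnt0 t) ->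
    select n w mask (iter (code_length m) decode_step (0, f, b)).1.2 = C b.
  move=> h; apply: eq_select => j; apply: (@decode_agree (2 ^ m)) => //.
  exact: hmask.
have eZ : evale x s0 (EVar vZ) = 2 ^ code_length m by rewrite /= /upd /=
  (ready_z hr).
have : (fun b s' => (sv s' vFound != 0 ->
     covers m bit (capped req k.+1) (select n w mask (av s' aBest)) /\
     sv s' vBest = total_weight w (select n w mask (av s' aBest))) /\
   (forall b', b' < b -> covers m bit (capped req k.+1) (C b') ->
     sv s' vFound != 0 /\ sv s' vBest <= total_weight w (C b')))
  (evale x s0 (EVar vZ)) s'.
  apply: (@forP x vS (EVar vZ) candidate s0 (fun b s' => (sv s' vFound != 0 ->
     covers m bit (capped req k.+1) (select n w mask (av s' aBest)) /\
     sv s' vBest = total_weight w (select n w mask (av s' aBest))) /\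
   (forall b', b' < b -> covers m bit (capped req k.+1) (C b') ->
     sv s' vFound != 0 /\ sv s' vBest <= total_weight w (C b'))))
    => [//|b s1 lb fv fa [h1 h2]].
  set s2 := setv s1 vS b.
  have hr2 : ready x n m w mask req bit s2.
    apply: ready_setv => //; apply: ready_frame hr _ _ => [u hu|a ha].
      rewrite fv; last by move: u hu; apply/allP.
      by rewrite /= /upd ifN //; move: u hu; apply/allP.
    by rewrite fa //; move: a ha; apply/allP.
  have k2 : sv s2 vK = k by rewrite /= /upd /= fv.
  have [cnt [cE cD]] := decodeP x s2.
  have := candidateP hmask hr2; cbv zeta.
  rewrite cD (ready_e hr2) [sv s2 vS]/= selE; last first.
    move=> t lt; rewrite cE ?(ready_t hr2) // (ready_d hr2) /cnt0 /=.
    by rewrite fa.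
  rewrite k2; set s3 := eval x candidate s2 => -[[cC [hF [f3 [b3 e3]]]]|[nC [f3
    [b3 e3]]]].
    rewrite f3 b3 e3; split=> // b'; rewrite ltnS leq_eqVlt => /orP[/eqP ->
      //|lb' cb'].
    have [f1 l1] := h2 b' lb' cb'; split=> //.
    case: hF => [f0|hF]; last exact: leq_trans (ltnW hF) l1.
    by move: f1; rewrite -[sv s1 _]/(sv s2 vFound) f0.
  rewrite f3 b3 e3; split; first exact: h1.
  move=> b'; rewrite ltnS leq_eqVlt => /orP[/eqP -> cb|]; last exact: h2.
  have f1 : sv s1 vFound != 0 by apply/eqP => f0; case: nC; split=> //; left.
  split=> //.
  by rewrite leqNgt; apply/negP => lw; case: nC; split=> //; right.
rewrite eZ => -[h1 h2]; split=> // c hc cc.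
have [t|| b lb hb] := @decode_onto c (code_length m) (2 ^ m) 0 cnt0.
- by rewrite add0n => /andP[_ lt]; case/andP: (hc t lt).
- rewrite add0n /code_length -[X in _ <= X * _]subn0 -sum_nat_const_nat.
  rewrite big_nat [X in _ <= X]big_nat; apply: leq_sum => t /andP[_ lt].
  by have := hc t lt; rewrite /cnt0; lia.
have eC : C b = select n w mask c.
  apply: eq_select => j; apply: (proj1 (hb _)); exact: hmask.
by rewrite -eC; apply: h2 => //; rewrite eC.
Qed.

(** * From one stage to the next *)

Definition update : cmd :=
  If (EVar vFound)
    (For vI (EVar vT) (AStore aCur (EVar vI) (EConst 0));;
     For vJ (EVar vN)
       (If (selected aBest)
          (AStore aCur (EArr aMask (EVar vJ))
             (EAdd (EArr aCur (EArr aMask (EVar vJ))) (EConst 1)))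
          skip))
    skip.

(** A candidate may ask for more sets of a type than exist, so the current counts are recounted from
    the selected sets instead of being copied from [aBest]. *)
Lemma updateP x n m w mask req bit s :
  ready x n m w mask req bit s -> sv s vFound != 0 ->
  forall t, t < 2 ^ m -> av (eval x update s) aCur t =
    type_count mask (select n w mask (av s aBest)) t.
Proof.
move=> hr hf; rewrite /update.
set c1 := For vI _ _; set c2 := For vJ _ _.
have -> : eval x (If (EVar vFound) (c1;; c2) skip) s =
    if sv s vFound != 0 then eval x c2 (eval x c1 s) else eval x skip s by [].
rewrite hf; set s1 := eval x c1 s.
have z1 : forall t, t < sv s vT -> av s1 aCur t = 0.
  apply: (@forP x vI (EVar vT) _ s (fun i s' => forall t, t < i ->
    av s' aCur t = 0)) => [//|i s' li _ _ h] t lt.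
  by rewrite /= /upd /=; case: (eqVneq t i) => [//|nt]; apply: h; lia.
rewrite (ready_t hr) in z1.
have hr1 : ready x n m w mask req bit s1 by apply: ready_eval.
set sel := fun j => rank n w mask j < av s aBest (mask j).
have b1 : av s1 aBest = av s aBest by rewrite /s1 eval_framea.
have E t : type_count mask (select n w mask (av s aBest)) t =
    \sum_(0 <= j < n) (sel j && (mask j == t)).
  rewrite big_mkord /type_count big_mkcond; apply: eq_bigr => j _.
  by rewrite inE -/(sel j); case: (sel j).
move=> t lt; rewrite E; move: t lt.
have en : evale x s1 (EVar vN) = n by rewrite /= (ready_n hr1).
suff : (fun j0 s' => forall t, t < 2 ^ m -> av s' aCur t =
    \sum_(0 <= j < j0) (sel j && (mask j == t))) (evale x s1 (EVar vN)) (eval x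
      c2 s1).
  by rewrite en.
apply: (@forP x vJ (EVar vN) _ s1 (fun j0 s' => forall t, t < 2 ^ m ->
  av s' aCur t = \sum_(0 <= j < j0) (sel j && (mask j == t))))
  => [t lt|j s' lj fv fa h t lt].
  by rewrite big_geq // z1.
rewrite en in lj; rewrite big_nat_recr //= -h //= /upd /=.
rewrite (fa aMask) // (fa aRank) // (fa aBest) // (ready_mask hr1 lj)
  (ready_rank hr1 lj) b1.
have -> : (av s aBest (mask j) - rank n w mask j != 0) = sel j by rewrite /sel; lia.
case: (sel j) => //=; last by rewrite addn0.
rewrite /upd [mask j == t]eq_sym.
by case: eqP => [->|_]; rewrite ?addn0.
Qed.

Definition stages : cmd := For vK (EVar vN1) (search;; update).

(** With cap 0 the empty cover is optimal and all counts are 0, as in the initial array. A cover for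
    the next cap is also one for the present cap, so once a cap is infeasible all later ones are,
    and the invariant holds vacuously. *)
Lemma stagesP x n m (w mask req : nat -> nat) (bit : nat -> nat -> bool) s :
  (forall j, j < n -> mask j < 2 ^ m) ->
  (forall (i j : 'I_n) k, mask i = mask j -> bit i k = bit j k) ->
  ready x n m w mask req bit s ->
  (forall t, t < 2 ^ m -> av s aCur t = 0) -> 0 < sv s vN1 ->
  let s' := eval x stages s in
  (sv s' vFound != 0 -> exists X : {set 'I_n},
     covers m bit (capped req (sv s vN1)) X /\ sv s' vBest = total_weight w X) /\
  (forall Y : {set 'I_n}, covers m bit (capped req (sv s vN1)) Y ->
     sv s' vFound != 0 /\ sv s' vBest <= total_weight w Y).
Proof.
move=> hmask hbit hr hcur hN.
have hmaskO (j : 'I_n) : mask j < 2 ^ m by apply: hmask.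
(* The last two clauses wait for [0 < k] because [vFound] and [vBest] get their meaning from the
   first search. *)
pose Inv k s' := [/\ forall Y : {set 'I_n}, covers m bit (capped req k) Y ->
     exists X : {set 'I_n}, [/\ covers m bit (capped req k) X,
       forall X' : {set 'I_n}, covers m bit (capped req k) X' ->
         total_weight w X <= total_weight w X' &
       forall t, t < 2 ^ m -> av s' aCur t = type_count mask X t],
   0 < k -> sv s' vFound != 0 -> exists X : {set 'I_n},
     covers m bit (capped req k) X /\ sv s' vBest = total_weight w X &
   0 < k -> forall Y : {set 'I_n}, covers m bit (capped req k) Y ->
     sv s' vFound != 0 /\ sv s' vBest <= total_weight w Y].
suff : Inv (evale x s (EVar vN1)) (eval x stages s).
  by move=> [_ h1 h2]; split; [apply: h1|apply: h2].
apply: forP => [|k s1 lk fv fa [h1 _ _]].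
  split=> // Y _; exists set0; split.
  - by move=> i _; rewrite /capped minn0.
  - by move=> X' _; rewrite /total_weight big_set0.
  - by move=> t lt; rewrite hcur // /type_count big_set0.
rewrite eval_seq; set s2 := setv s1 vK k; set s3 := eval x search s2.
set s4 := eval x update s3.
have hr2 : ready x n m w mask req bit s2.
  apply: ready_setv => //; apply: ready_frame hr _ _ => [u hu|a ha].
    by rewrite fv //; move: u hu; apply/allP.
  by rewrite fa //; move: a ha; apply/allP.
have hr3 : ready x n m w mask req bit s3 by apply: ready_eval.
have k2 : sv s2 vK = k by [].
have f4 : sv s4 vFound = sv s3 vFound by rewrite /s4 eval_framev.
have b4 : sv s4 vBest = sv s3 vBest by rewrite /s4 eval_framev.
have [hs1 hs2] := searchP hmask hr2; rewrite k2 -/s3 in hs1 hs2.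
have best (Y : {set 'I_n}) : covers m bit (capped req k.+1) Y ->
    sv s3 vFound != 0 /\ sv s3 vBest <= total_weight w Y.
  move=> cY; have cYk : covers m bit (capped req k) Y.
    by move=> i li; apply: leq_trans (cY i li); rewrite /capped; lia.
  have [X [cX oX eX]] := h1 Y cYk.
  have [c [hc cc wc]] := next_type_counts hmaskO hbit cX oX cY.
  have [|f3 l3] := hs2 c _ cc; first by move=> t lt; rewrite /= eX.
  by split=> //; apply: leq_trans wc.
split.
- move=> Y cY; have [f3 _] := best Y cY; have [cB wB] := hs1 f3.
  exists (select n w mask (av s3 aBest)); split=> //.
    by move=> X' cX'; rewrite -wB; have [] := best X' cX'.
  by move=> t lt; rewrite /s4 (updateP hr3).
- move=> _; rewrite f4 b4 => f3; exists (select n w mask (av s3 aBest)).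
  exact: hs1.
- by move=> _ Y cY; rewrite f4 b4; apply: best.
Qed.

(** * The whole program: correctness and running time *)

Definition decide : cmd :=
  Assign vOut (EConst 0);;
  If (EVar vFound)
    (If (ESub (EAdd (EVar vP) (EConst 1)) (EAdd (EVar vBest) (EVar vQ)))
       (Assign vOut (EConst 1)) skip)
    skip.

Lemma decideP x s : sv (eval x decide s) vOut =
  (sv s vFound != 0) && (sv s vBest + sv s vQ <= sv s vP).
Proof.
rewrite /= /upd /=; case: (sv s vFound != 0) => //=; case: leqP => h /=.
  by rewrite ifT //; lia.
by rewrite ifN //; lia.
Qed.

Definition multicover_program : cmd :=
  Assign vLen (EVar vOut);; read_nat;; Assign vM (EVar vVal);;
  read_nat;; Assign vN (EVar vVal);;
  Assign vN1 (EAdd (EVar vN) (EConst 1));;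
  compute_bounds;; parse_sets;; parse_requirements;; parse_budget;;
  compute_ranks;; stages;; decide.

Lemma eq_rank n (w w' mask mask' : nat -> nat) j : j < n ->
  (forall i, i < n -> w i = w' i) -> (forall i, i < n -> mask i = mask' i) ->
  rank n w mask j = rank n w' mask' j.
Proof.
move=> lj hw hm; apply: eq_bigr => i _.
by rewrite /before !hw ?hm // hm.
Qed.

(** [cost_leq] does not apply to the whole program, which assigns its own loop bounds; it is applied
    between these assignments and the pieces are chained. *)
Lemma seq_cost_leq x c1 c2 s N : 1 < N -> cost x c1 s <= N ^ degree c1 ->
  cost x c2 (eval x c1 s) <= N ^ degree c2 ->
  cost x (c1;; c2) s <= N ^ degree (c1;; c2).
Proof.
move=> hN h1 h2; apply: leq_trans (expn_add_leq _ _ hN); exact: leq_add.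
Qed.

(** One number dominates all loop bounds that depend on the parameter alone. *)
Lemma code_length_bounds m :
  [/\ m <= 2 ^ code_length m, 2 ^ m <= 2 ^ code_length m,
      2 ^ m.+2 <= 2 ^ code_length m & code_length m <= 2 ^ code_length m].
Proof.
have a1 : m < 2 ^ m by apply: ltn_expl.
have a2 : 2 ^ m.+2 < window m by apply: ltn_expl.
have a3 : code_length m < 2 ^ code_length m by apply: ltn_expl.
have a4 : 2 ^ m.+2 = 4 * 2 ^ m by rewrite !expnS; lia.
have a5 : window m < code_length m by rewrite /code_length; nia.
by split; lia.
Qed.

Lemma compute_bounds_cost x s N : 1 < N -> 2 ^ code_length (sv s vM) <= N ->
  cost x compute_bounds s <= N ^ degree compute_bounds.
Proof.
move=> hN; have [b1 b2 b3 b4] := code_length_bounds (sv s vM) => hZ.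
rewrite /compute_bounds.
apply: seq_cost_leq => //; first exact: (@cost_leq _ [::]).
set s1 := eval x (Assign _ _) s.
apply: seq_cost_leq => //.
  apply: (@cost_leq _ [:: vM]) => // v; rewrite inE => /eqP ->.
  by rewrite /= /upd /=; apply: leq_trans hZ.
set s2 := eval x (double_loop _ _) s1.
have T2 : sv s2 vT = 2 ^ sv s vM by rewrite /s2 double_loopP //= /upd /= mul1n.
apply: seq_cost_leq => //; first exact: (@cost_leq _ [::]).
set s3 := eval x (Assign _ _) s2.
apply: seq_cost_leq => //; first exact: (@cost_leq _ [::]).
set s4 := eval x (Assign _ _) s3.
apply: seq_cost_leq => //.
  apply: (@cost_leq _ [:: vU]) => // v; rewrite inE => /eqP ->.
  rewrite /= /upd /= [sv s2 _]T2; apply: leq_trans hZ; move: b3; rewrite !expnS;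
    lia.
set s5 := eval x (double_loop _ _) s4.
have D5 : sv s5 vD = window (sv s vM).
  rewrite /s5 double_loopP //= /upd /= mul1n [sv s2 _]T2 /window !expnS; congr
    (_ ^ _).
  by lia.
have T5 : sv s5 vT = 2 ^ sv s vM by rewrite /s5 eval_framev.
apply: seq_cost_leq => //; first exact: (@cost_leq _ [::]).
set s6 := eval x (Assign _ _) s5.
apply: seq_cost_leq => //.
  apply: (@cost_leq _ [:: vT]) => // v; rewrite inE => /eqP ->.
  by rewrite /= /upd /= T5; apply: leq_trans hZ.
set s7 := eval x (For _ _ _) s6.
apply: seq_cost_leq => //; first exact: (@cost_leq _ [::]).
apply: (@cost_leq _ [:: vE]) => // v; rewrite inE => /eqP ->.
have [_ _ e _] := compute_boundsP x s.
apply: leq_trans hZ; apply: leq_trans b4; rewrite -e leq_eqVlt; apply/orP; left.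
by rewrite eq_sym /compute_bounds !eval_seq eval_framev.
Qed.

(* Sets of negative weight may always be taken: they become free, and the
   budget grows by the absolute values of their weights. *)
Lemma multicover_nonneg (I : multicover_instance) (w req : nat -> nat)
    (bit : nat -> nat -> bool) (P Q : nat) :
  (forall j : 'I_(family_size I), w j = pos_part (weight j)) ->
  (forall i : 'I_(universe_size I), req i = pos_part (requirement i)) ->
  (forall (j : 'I_(family_size I)) (i : 'I_(universe_size I)),
     bit j i = (i \in cover_set j)) ->
  P = \sum_(j < family_size I) neg_part (weight j) + pos_part (budget I) ->
  Q = neg_part (budget I) ->
  weighted_set_multicover I <->
  exists J : {set 'I_(family_size I)},
    covers (universe_size I) bit (capped req (family_size I).+1) J /\
    total_weight w J + Q <= P.
Proof.
set n := family_size I; set m := universe_size I => hw hreq hbit hP hQ.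
have covE (J : {set 'I_n}) (i : 'I_m) :
    covered bit J i = #|[set j in J | i \in cover_set j]|.
  rewrite /covered (sum_nat_set _ (fun j => bit j i)); apply: eq_card => j.
  by rewrite !inE hbit.
have part z : z = (Posz (pos_part z) - Posz (neg_part z))%R.
  by rewrite /pos_part /neg_part; case: ifP; lia.
have wE (J : {set 'I_n}) : (\sum_(j in J) weight j =
    Posz (total_weight w J) - Posz (\sum_(j in J) neg_part (weight j)))%R.
  rewrite /total_weight !Posz_sum -sumrB; apply: eq_bigr => j _.
  by rewrite hw -part.
have negle (J : {set 'I_n}) : \sum_(j in J) neg_part (weight j) <=
    \sum_(j < n) neg_part (weight j).
  by rewrite [X in X <= _]big_mkcond; apply: leq_sum => j _; case: ifP.
have bE := part (budget I).
split=> [[J [cJ bJ]]|[J [cJ bJ]]].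
  exists J; split.
    move=> i li; have := cJ (Ordinal li); rewrite -covE.
    have := hreq (Ordinal li); rewrite /capped /pos_part /=.
    by case: ifP; lia.
  have := negle J; move: bJ; rewrite wE; lia.
pose J' := J :|: [set j | (weight j < 0)%R].
exists J'; split.
  move=> i; rewrite -covE; have := cJ i (ltn_ord i); rewrite /capped hreq.
  have le1 : covered bit J i <= covered bit J' i.
    rewrite /covered big_mkcond [X in _ <= X]big_mkcond; apply: leq_sum => j _.
    by rewrite inE; case: (j \in J).
  (* No coverage reaches n + 1, so meeting a requirement capped there shows that the cap was
     inactive. *)
  have le2 : covered bit J' i <= n.
    rewrite covE -[X in _ <= X]card_ord; exact: max_card.
  move: le1 le2; rewrite {2}(part (requirement i)).
  move: (covered bit J i) (covered bit J' i) (pos_part _) (neg_part _); lia.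
have negJ' : \sum_(j in J') neg_part (weight j) = \sum_(j < n) neg_part (weight j).
  rewrite big_mkcond; apply: eq_bigr => j _; rewrite !inE /neg_part.
  by case: (weight j < 0)%R; rewrite ?orbT // orbF; case: ifP.
have posJ' : total_weight w J' = total_weight w J.
  rewrite /total_weight big_mkcond [RHS]big_mkcond; apply: eq_bigr => j _.
  rewrite !inE hw /pos_part; case: (weight j < 0)%R; rewrite ?orbF //.
  by rewrite orbT; case: ifP.
rewrite wE negJ' posJ'; lia.
Qed.

(** Every set contributes at least the sign of its weight to the encoding, so loops over the family
    and the n + 1 stages are linear in the input length. *)
Lemma size_encode_instance (I : multicover_instance) :
  (family_size I).+1 < size (encode_instance I).
Proof.
rewrite /encode_instance /encode_nat !size_cat /=.
suff : family_size I <= size (flatten [seq encode_set (cover_set j) ++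
    encode_int (weight j) | j <- enum 'I_(family_size I)]) by lia.
rewrite size_flatten /shape -map_comp sumnE big_map.
rewrite -[X in X <= _](size_enum_ord (family_size I)) -sum1_size.
by apply: leq_sum => j _ /=; rewrite size_cat /=; lia.
Qed.

(** The product [N] dominates both kinds of loop bounds, those given by the parameter and those
    given by the input. *)
Lemma multicover_programP (I : multicover_instance) :
  let x := encode_instance I in
  let N := 2 ^ code_length (universe_size I) * size x in
  cost x multicover_program (start x) <= N ^ degree multicover_program /\
  exists b : bool, (b <-> weighted_set_multicover I) /\
    sv (eval x multicover_program (start x)) 0 = b.
Proof.
set n := family_size I; set m := universe_size I => x N.
pose d : seq bool * int := ([::], 0%R).
pose l := [seq (encode_set (cover_set j), weight j) | j <- enum 'I_n].
pose rl := [seq requirement i | i <- enum 'I_m].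
have sl : size l = n by rewrite size_map size_enum_ord.
have srl : size rl = m by rewrite size_map size_enum_ord.
have lE (j : 'I_n) : nth d l j = (encode_set (cover_set j), weight j).
  by rewrite (nth_map j) ?size_enum_ord // nth_ord_enum.
have rlE (i : 'I_m) : nth 0%R rl i = requirement i.
  by rewrite (nth_map i) ?size_enum_ord // nth_ord_enum.
have el e : e \in l -> size e.1 = m.
  by move=> /mapP[j _ ->]; rewrite /= size_map size_enum_ord.
have seE j : j < n -> size (nth d l j).1 = m.
  by move=> lj; apply: el; apply: mem_nth; rewrite sl.
have xE : x = encode_nat m ++ encode_nat n ++
    flatten [seq e.1 ++ encode_int e.2 | e <- l] ++
    flatten [seq encode_int z | z <- rl] ++ encode_int (budget I).
  by rewrite /x /encode_instance /l /rl -!map_comp.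
pose w j := pos_part (nth d l j).2.
pose mask j := mask_value (nth d l j).1.
pose bit j i := nth false (nth d l j).1 i.
pose req i := pos_part (nth 0%R rl i).
have hmask j : j < n -> mask j < 2 ^ m.
  by move=> lj; rewrite /mask -[in X in _ < X](seE j lj); apply: mask_value_ltn.
have hbit (i j : 'I_n) k : mask i = mask j -> bit i k = bit j k.
  by move=> e; rewrite /bit (mask_value_inj _ e) // !seE.
have [c1 c2 c3 c4] := code_length_bounds m.
have nx : n.+1 < size x by apply: size_encode_instance.
have hZN : 2 ^ code_length m <= N.
  by rewrite /N -[X in X <= _]muln1 leq_mul2l; apply/orP; right; lia.
have hxN : size x <= N.
  by rewrite /N -[X in X <= _]mul1n leq_mul2r expn_gt0 orbT.
have hN : 1 < N by lia.
(* Cost and answer are carried together, so that peeling off a command by [step0] runs it only once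
   in the proof. *)
pose R (c : cmd) (s : state) :=
  cost x c s <= N ^ degree c /\
  exists b : bool, (b <-> weighted_set_multicover I) /\ sv (eval x c s) 0 = b.
have step0 c1' c2' s : cost x c1' s <= N ^ degree c1' ->
    R c2' (eval x c1' s) -> R (c1';; c2') s.
  by move=> h1 [h2 h3]; split=> //; apply: seq_cost_leq.
have assign_cost v e s : cost x (Assign v e) s <= N ^ degree (Assign v e).
  exact: (@cost_leq _ [::]).
rewrite -/(R _ _) /multicover_program.
apply: (step0) => //; set s1 := eval x (Assign _ _) _.
have len1 : sv s1 vLen = size x by [].
apply: (step0); first by apply: (@cost_leq _ [:: vLen]) => // v; rewrite inE =>
  /eqP ->; rewrite len1.
set s2 := eval x read_nat s1.
have [v2 p2] : sv s2 vVal = m /\ drop (sv s2 vPtr) x = encode_nat n ++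
    flatten [seq e.1 ++ encode_int e.2 | e <- l] ++
    flatten [seq encode_int z | z <- rl] ++ encode_int (budget I).
  by apply: read_natP => //; rewrite [sv s1 vPtr]/= drop0 -xE.
apply: (step0) => //; set s3 := eval x (Assign _ _) _.
have len3 : sv s3 vLen = size x by rewrite /= /upd /= /s2 eval_framev.
apply: (step0); first by apply: (@cost_leq _ [:: vLen]) => // v; rewrite inE =>
  /eqP ->; rewrite len3.
set s4 := eval x read_nat s3.
have [v4 p4] : sv s4 vVal = n /\ drop (sv s4 vPtr) x =
    flatten [seq e.1 ++ encode_int e.2 | e <- l] ++
    flatten [seq encode_int z | z <- rl] ++ encode_int (budget I).
  by apply: read_natP.
have m4 : sv s4 vM = m by rewrite /s4 eval_framev.
have len4 : sv s4 vLen = size x by rewrite /s4 eval_framev.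
apply: (step0) => //; set s5 := eval x (Assign _ _) _.
apply: (step0) => //; set s6 := eval x (Assign _ _) _.
have m6 : sv s6 vM = m by [].
have n6 : sv s6 vN = n by [].
have n16 : sv s6 vN1 = n.+1 by rewrite /= /upd /= v4 addn1.
have p6 : drop (sv s6 vPtr) x = flatten [seq e.1 ++ encode_int e.2 | e <- l] ++
    flatten [seq encode_int z | z <- rl] ++ encode_int (budget I) by [].
have len6 : sv s6 vLen = size x by [].
have P6 : sv s6 vP = 0.
  by rewrite /= /upd /= /s4 eval_framev //= /upd /= /s2 eval_framev.
have Q6 : sv s6 vQ = 0.
  by rewrite /= /upd /= /s4 eval_framev //= /upd /= /s2 eval_framev.
have cur6 : av s6 aCur = fun=> 0.
  by rewrite /= /s4 eval_framea //= /s2 eval_framea.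
(* From here on [s6] is an arbitrary state with the listed properties. *)
move: {s1 len1 v2 p2 len3 v4 p4 m4 len4 s2 s3 s4 s5} s6 m6 n6 n16 p6 len6 P6 Q6
  cur6.
move=> s6 m6 n6 n16 p6 len6 P6 Q6 cur6.
apply: (step0); first by apply: compute_bounds_cost; rewrite ?m6.
set s7 := eval x compute_bounds s6.
have [t7 d7 e7 z7] := compute_boundsP x s6; rewrite m6 -/s7 in t7 d7 e7 z7.
have f7 v : v \notin modv compute_bounds -> sv s7 v = sv s6 v by apply: eval_framev.
have m7 : sv s7 vM = m by rewrite f7.
have n7 : sv s7 vN = n by rewrite f7.
have len7 : sv s7 vLen = size x by rewrite f7.
have lim v : v \in [:: vLen; vM; vN] -> forall s, sv s vLen = size x ->
    sv s vM = m -> sv s vN = n -> sv s v <= N.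
  rewrite !inE => hv s h1 h2 h3; case/or3P: hv => /eqP ->.
  - by rewrite h1.
  - by rewrite h2; lia.
  - by rewrite h3; lia.
apply: (step0); first by apply: (@cost_leq _ [:: vLen; vM; vN]) => // v hv;
  apply: lim.
set s8 := eval x parse_sets s7.
have [p8 P8 a8] : [/\ drop (sv s8 vPtr) x =
      flatten [seq encode_int z | z <- rl] ++ encode_int (budget I),
      sv s8 vP = sv s7 vP + \sum_(e <- l) neg_part e.2 &
      forall j, j < size l -> let e := nth d l j in
        [/\ av s8 aMask j = mask_value e.1, av s8 aWt j = pos_part e.2 &
            forall i, i < sv s7 vM ->
              nth false x (av s8 aPos j + i) = nth false e.1 i]].
  apply: parse_setsP; rewrite ?len7 ?n7 ?sl //.
    by move=> e he; rewrite m7 el.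
  by rewrite f7.
have f8 v : v \notin modv parse_sets -> sv s8 v = sv s7 v by apply: eval_framev.
have m8 : sv s8 vM = m by rewrite f8.
have n8 : sv s8 vN = n by rewrite f8.
have len8 : sv s8 vLen = size x by rewrite f8.
apply: (step0); first by apply: (@cost_leq _ [:: vLen; vM; vN]) => // v hv;
  apply: lim.
set s9 := eval x parse_requirements s8.
have [p9 a9] : drop (sv s9 vPtr) x = encode_int (budget I) /\
    forall j, j < size rl -> av s9 aReq j = pos_part (nth 0%R rl j).
  by apply: parse_requirementsP => //; rewrite m8 srl.
have f9 v : v \notin modv parse_requirements -> sv s9 v = sv s8 v by apply:
  eval_framev.
have m9 : sv s9 vM = m by rewrite f9.
have n9 : sv s9 vN = n by rewrite f9.
have len9 : sv s9 vLen = size x by rewrite f9.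
apply: (step0); first by apply: (@cost_leq _ [:: vLen; vM; vN]) => // v hv;
  apply: lim.
set s10 := eval x parse_budget s9.
have [Q10 P10] : sv s10 vQ = neg_part (budget I) /\
    sv s10 vP = sv s9 vP + pos_part (budget I).
  by apply: parse_budgetP => //; rewrite f9 // f8 // f7.
have f10 v : v \notin modv parse_budget -> sv s10 v = sv s9 v by apply: eval_framev.
have m10 : sv s10 vM = m by rewrite f10.
have n10 : sv s10 vN = n by rewrite f10.
have len10 : sv s10 vLen = size x by rewrite f10.
have a10 a : a \in [:: aPos; aMask; aWt] -> av s10 a = av s8 a.
  rewrite !inE => ha; rewrite /s10 eval_framea // /s9 eval_framea //.
  by case/or3P: ha => /eqP ->.
apply: (step0); first by apply: (@cost_leq _ [:: vLen; vM; vN]) => // v hv;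
  apply: lim.
set s11 := eval x compute_ranks s10.
have f11 v : v \notin modv compute_ranks -> sv s11 v = sv s10 v by apply:
  eval_framev.
have a11 a : a != aRank -> av s11 a = av s10 a.
  by move=> ha; apply: eval_framea; rewrite [moda _]/= inE.
have hr : ready x n m w mask req bit s11.
  have hW j : j < n -> av s10 aWt j = w j.
    by move=> lj; rewrite a10 //; have [] := a8 j _; rewrite ?sl.
  have hM j : j < n -> av s10 aMask j = mask j.
    by move=> lj; rewrite a10 //; have [] := a8 j _; rewrite ?sl.
  split.
  - by rewrite f11.
  - by rewrite f11.
  - by rewrite f11 // f10 // f9 // f8.
  - by rewrite f11 // f10 // f9 // f8.
  - by rewrite f11 // f10 // f9 // f8.
  - by rewrite f11 // f10 // f9 // f8.
  - by move=> j lj; rewrite a11 ?hM.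
  - by move=> j lj; rewrite a11 ?hW.
  - move=> j lj; rewrite /s11 compute_ranksP n10 //; exact: eq_rank.
  - by move=> i li; rewrite a11 // /s10 eval_framea // a9 ?srl.
  - move=> j i lj li; rewrite a11 // a10 //.
    by have [|_ _] := a8 j _; [rewrite sl|rewrite m7; apply].
have cur11 t : av s11 aCur t = 0.
  by rewrite a11 // /s10 eval_framea // /s9 eval_framea // /s8 eval_framea //
    /s7 eval_framea // cur6.
have N11 : sv s11 vN1 = n.+1 by rewrite f11 // f10 // f9 // f8 // f7.
apply: (step0).
  apply: (@cost_leq _ [:: vM; vN; vT; vE; vZ; vN1]) => // v; rewrite !inE.
  case/or4P => [/eqP ->|/eqP ->|/eqP ->|].
  - by rewrite (ready_m hr); lia.
  - by rewrite (ready_n hr); lia.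
  - by rewrite (ready_t hr); lia.
  case/or3P => /eqP ->.
  - by rewrite (ready_e hr); lia.
  - by rewrite (ready_z hr); lia.
  - by rewrite N11; lia.
set s12 := eval x stages s11.
split; first exact: (@cost_leq _ [::]).
have [g1 g2] : (sv s12 vFound != 0 -> exists X : {set 'I_n},
     covers m bit (capped req n.+1) X /\ sv s12 vBest = total_weight w X) /\
  (forall Y : {set 'I_n}, covers m bit (capped req n.+1) Y ->
     sv s12 vFound != 0 /\ sv s12 vBest <= total_weight w Y).
  by rewrite -N11; apply: (stagesP hmask hbit hr) => //; rewrite N11.
have P12 : sv s12 vP = \sum_(j < n) neg_part (weight j) + pos_part (budget I).
  rewrite /s12 eval_framev // f11 // P10 f9 // P8 f7 // P6 add0n; congr (_ + _).
  by rewrite big_map big_enum.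
have Q12 : sv s12 vQ = neg_part (budget I) by rewrite /s12 eval_framev // f11.
exists ((sv s12 vFound != 0) && (sv s12 vBest + sv s12 vQ <= sv s12 vP)).
split; last exact: decideP.
have hw (j : 'I_n) : w j = pos_part (weight j) by rewrite /w lE.
have hreq (i : 'I_m) : req i = pos_part (requirement i) by rewrite /req rlE.
have hb (j : 'I_n) (i : 'I_m) : bit j i = (i \in cover_set j).
  by rewrite /bit lE /= (nth_map i) ?size_enum_ord // nth_ord_enum.
rewrite (multicover_nonneg hw hreq hb P12 Q12); split.
  case/andP => /g1[X [cX ->]] le; by exists X.
move=> [J [cJ wJ]]; have [-> le] := g2 J cJ.
by apply: leq_trans wJ; rewrite leq_add2r.
Qed.

(** * Computability of the parameter-dependent factor *)

Definition bound_program (dg : nat) : cmd :=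
  Assign vM (EVar vOut);; compute_bounds;;
  Assign vU (EConst dg);; Assign vOut (EConst 1);;
  For vJ (EVar vE) (double_loop vOut vU).

(** The argument is unary, so register 0 already holds it and [compute_bounds] can be reused; then
    [code_length k] rounds of [dg] doublings give the power. No time limit is imposed, so the cost
    itself serves as [t]. *)
Lemma computable_bound dg : computable (fun k => (2 ^ code_length k) ^ dg).
Proof.
exists (compile (bound_program dg)) => k.
set x := nseq k true; exists (cost x (bound_program dg) (start x)).
have := @compileP x (bound_program dg) _ isT (leqnn _).
suff -> : sv (eval x (bound_program dg) (start x)) 0 = (2 ^ code_length k) ^ dg
  by [].
rewrite /bound_program.
rewrite eval_seq; set s1 := eval x (Assign _ _) _.
rewrite eval_seq; set s2 := eval x compute_bounds s1.
rewrite eval_seq; set s3 := eval x (Assign _ _) _.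
rewrite eval_seq; set s4 := eval x (Assign _ _) _.
have [_ _ e2 _] := compute_boundsP x s1.
have e4 : evale x s4 (EVar vE) = code_length k.
  by rewrite /= /upd /= [sv s2 _]e2 /= /upd /= size_nseq.
rewrite -e4 -expnM mulnC expnM.
apply: (@forP x vJ (EVar vE) _ s4 (fun i s' => sv s' 0 = (2 ^ dg) ^ i))
  => [//|i s' _ fv _ h].
by rewrite double_loopP //= /upd /= h (fv vU) // expnS mulnC.
Qed.

Theorem theorem3 :
  fixed_parameter_tractable encode_instance weighted_set_multicover
    universe_size.
Proof.
set dg := degree multicover_program.
(* [dg] is determined by the program text, so N^dg splits into a factor depending on the parameter
   and a fixed power of the input length. *)
exists (compile multicover_program), (fun k => (2 ^ code_length k) ^ dg), dg.
split; first exact: computable_bound.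
move=> I; have [hc [b [hb eb]]] := multicover_programP I.
exists b; split=> //; rewrite -eb; apply: compileP => //.
by rewrite -expnMn.
Qed.
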